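(* Let $g\in M(I)$, let $\mathcal{G}=\mathcal{G}_g$ be the ultragraph induced by $g$, let $x\in E_g$, and let $J$ be the unique index with $g^{\tau(x)}(x)\in E_J$. Let $X\subseteq\mathcal{G}^0$. If for all $v_i\in X$ we have $\mathring{I_i}\cap g^{-1}(E_J)=\emptyset$, then the representations $\nu_x$ and $\pi_x$ of $C^*(\mathcal{G},X)$ on $\ell^2(R_g(x))$ coincide, where $\nu_x$ is the representation with $\nu_x(p_B)=W_B$, $\nu_x(s_{e_i})=T_{e_i}$, and $\pi_x$ is the representation induced by the $(\mathcal{G},X)$-relative branching system $\{D_A,R_{e_i},f_{e_i}\}_{A\in\mathcal{E},\,i\in\mathbb{N}}$ on $R_g(x)$ with counting measure given by $$D_A=\bigcup_{\{j:v_j\in A\}}(I_j\cap R_g(x)),\quad R_{e_i}=\bigcup_{\{j:v_j\in r(e_i)\}}g_i^{-1}(I_j\cap R_g(x)),\quad f_{e_i}:D_{r(e_i)}\to R_{e_i},\ f_{e_i}(y)=g_i^{-1}(y).$$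
   Context: $\mathbb{N}=\{1,2,\dots\}$. Let $I=[a,b)$ with $a\in\mathbb{R}$, $b\in\mathbb{R}\cup\{\infty\}$. A map $g$ belongs to the Markov class $M(I)$ if: (1) there are closed intervals $(I_n)_{n\in\mathbb{N}}$ with $\max(I_j)\le\min(I_{j+1})$, $|I_i\cap I_j|\le1$ for $i\neq j$, $\mathrm{dom}(g)=\bigcup_nI_n\subseteq I$, $\min(I_1)=a$ and $\sup(I_n)\to b$; (2) $g|_{\mathring{I_i}}$ is injective for each $i$ ($\mathring{I_i}$ is the interior), $\mathrm{Im}(g)\subseteq I$ and $g(\Gamma)\subseteq\Gamma$, where $\Gamma=\bigcup_n\partial I_n$; (3) for every $i$, $g(I_i)\cap\bigcup_nI_n$ is a nonempty union of intervals of the form $I_n$. Let $g_i=g|_{I_i}$ and let the escape sets be $E_n=(\max I_n,\min I_{n+1})$ (possibly empty), so $I=\bigcup_nI_n\cup\bigcup_nE_n$. The ultragraph $\mathcal{G}_g$ has vertices $\{v_i:i\in\mathbb{N}\}$, edges $\{e_i:i\in\mathbb{N}\}$, source $s(e_i)=v_i$ and range the set $r(e_i)=\{v_j:\mathring{I_j}\subseteq g(\mathring{I_i})\}$. $\mathcal{E}$ is the smallest family of subsets of $\mathcal{G}^0$ containing $\emptyset$, all $\{v_i\}$ and all $r(e_i)$, closed under finite unions and finite intersections. For $X\subseteq\mathcal{G}^0$, $C^*(\mathcal{G},X)$ is the universal $C^*$-algebra generated by partial isometries $s_e$ ($e\in\mathcal{G}^1$) with mutually orthogonal ranges and projections $p_A$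 ($A\in\mathcal{E}$) with $p_\emptyset=0$, $p_Ap_B=p_{A\cap B}$, $p_{A\cup B}=p_A+p_B-p_{A\cap B}$, $s_e^*s_e=p_{r(e)}$, $s_es_e^*\le p_{\{s(e)\}}$, and $p_{\{v\}}=\sum_{s(e)=v}s_es_e^*$ for every $v\in X$. $E_g=\bigcup_{k\in\mathbb{N}}g^{-k}\bigl(\bigcup_jE_j\bigr)$. For $x\in E_g$ let $\tau(x)\in\mathbb{N}$ be the unique number with $g^{\tau(x)-1}(x)\in\mathrm{dom}(g)$ and $g^{\tau(x)}(x)\notin\mathrm{dom}(g)$ ($g^0(x)=x$), and $R_g(x)=\{y\in\mathrm{dom}(g):g^n(y)=g^{\tau(x)}(x)\text{ for some }n\in\mathbb{N}\}$. $\ell^2(R_g(x))$ has orthonormal basis $\{\delta_y:y\in R_g(x)\}$. Define bounded operators by $W_B(\delta_y)=\chi_{\bigcup_{\{j:v_j\in B\}}I_j}(y)\,\delta_y$ and $T_{e_i}(\delta_y)=\chi_{\bigcup_{\{j:v_j\in r(e_i)\}}I_j}(y)\,\delta_{g_i^{-1}(y)}$, where, when the characteristic function is nonzero, $g_i^{-1}(y)$ is the unique preimage of $y$ under $g$ in $I_i$ (it lies in $\mathring{I_i}\cap R_g(x)$). The representation $\pi_x$ induced by the $(\mathcal{G},X)$-relative branching system $\{D_A,R_{e_i},f_{e_i}\}_{A\in\mathcal{E},\,i\in\mathbb{N}}$ on $R_g(x)$ with counting measure, where $D_A=\bigcup_{\{j:v_j\in A\}}(I_j\cap R_g(x))$,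 $R_{e_i}=\bigcup_{\{j:v_j\in r(e_i)\}}g_i^{-1}(I_j\cap R_g(x))$ and $f_{e_i}:D_{r(e_i)}\to R_{e_i}$, $f_{e_i}(y)=g_i^{-1}(y)$, is given, for $F\in\ell^2(R_g(x))$, by $\pi_x(p_A)(F)=\chi_{D_A}\cdot F$ and $\pi_x(s_{e_i})(F)=\chi_{R_{e_i}}\cdot(F\circ g_i)$ (functions extended by $0$ outside $R_{e_i}$). If $\mathring{I_i}\cap g^{-1}(E_J)=\emptyset$ for all $v_i\in X$, where $J$ is the unique index with $g^{\tau(x)}(x)\in E_J$, both $\nu_x$ and $\pi_x$ are well-defined $*$-homomorphisms $C^*(\mathcal{G},X)\to B(\ell^2(R_g(x)))$. *)

(* Defs.v *)
From HB Require Import structures.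
From mathcomp Require Import all_boot all_order all_algebra.
From mathcomp Require Import complex.
From mathcomp Require Import all_classical all_reals all_analysis.
From mathcomp Require Import ring.

Set Implicit Arguments.
Unset Strict Implicit.
Unset Printing Implicit Defensive.

Import Order.TTheory GRing.Theory Num.Theory.
Import numFieldNormedType.Exports.
Import ComplexField.Normc.

Local Open Scope classical_set_scope.
Local Open Scope ring_scope.

(* Complex C*-algebras, not assumed unital. *)

Record cstarAlg (R : realType) := CstarAlg {
  cs_car :> completeNormedModType R[i];
  cs_mul : cs_car -> cs_car -> cs_car;
  cs_star : cs_car -> cs_car;
  cs_mulA : forall a b c, cs_mul a (cs_mul b c) = cs_mul (cs_mul a b) c;
  cs_mulDl : forall a b c, cs_mul (a + b) c = cs_mul a c + cs_mul b c;
  cs_mulDr : forall a b c, cs_mul a (b + c) = cs_mul a b + cs_mul a c;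
  cs_mulZl : forall (z : R[i]) a b, cs_mul (z *: a) b = z *: cs_mul a b;
  cs_mulZr : forall (z : R[i]) a b, cs_mul a (z *: b) = z *: cs_mul a b;
  cs_starK : forall a, cs_star (cs_star a) = a;
  cs_starD : forall a b, cs_star (a + b) = cs_star a + cs_star b;
  cs_starZ : forall (z : R[i]) a, cs_star (z *: a) = conjc z *: cs_star a;
  cs_starM : forall a b, cs_star (cs_mul a b) = cs_mul (cs_star b) (cs_star a);
  cs_normM : forall a b, `|cs_mul a b| <= `|a| * `|b|;
  cs_normC : forall a, `|cs_mul (cs_star a) a| = `|a| ^+ 2
}.

Declare Scope cstar_scope.
Delimit Scope cstar_scope with cstar.
Notation "a *c b" := (cs_mul a b) (at level 40, left associativity) : cstar_scope.
Notation "a ^*" := (cs_star a) : cstar_scope.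
Local Open Scope cstar_scope.

Definition cs_le (R : realType) (A : cstarAlg R) (a b : A) : Prop :=
  exists c : A, b - a = c^* *c c.

Definition cs_projection (R : realType) (A : cstarAlg R) (a : A) : Prop :=
  a^* = a /\ a *c a = a.

Definition cs_partial_isometry (R : realType) (A : cstarAlg R) (a : A) : Prop :=
  a *c a^* *c a = a.

Definition star_hom (R : realType) (A B : cstarAlg R) (phi : A -> B) : Prop :=
  [/\ forall a b, phi (a + b) = phi a + phi b,
      forall (z : R[i]) a, phi (z *: a) = z *: phi a,
      forall a b, phi (a *c b) = phi a *c phi b
    & forall a, phi a^* = (phi a)^*].

Record ultragraph := Ultragraph {
  ug_vertex : Type;
  ug_edge : choiceType;
  ug_src : ug_edge -> ug_vertex;
  ug_rng : ug_edge -> set ug_vertex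
}.

Definition ug_sets (G : ultragraph) : set (set (ug_vertex G)) :=
  smallest
    (fun F => [/\ F set0,
                  forall A B, F A -> F B -> F (A `|` B)
                & forall A B, F A -> F B -> F (A `&` B)])
    ([set A | exists v : ug_vertex G, A = [set v]] `|` range (@ug_rng G)).

(* Only the values of [p] on [ug_sets G] are constrained. The sum in the last
   clause is a finite one: [X] is meant to contain no infinite emitter. *)
Definition ug_family (R : realType) (G : ultragraph) (X : set (ug_vertex G))
    (A : cstarAlg R) (s : ug_edge G -> A) (p : set (ug_vertex G) -> A) : Prop :=
  [/\ (forall e, cs_partial_isometry (s e)) /\
        (forall e f, e <> f -> (s e *c (s e)^*) *c (s f *c (s f)^*) = 0),
      forall B, ug_sets B -> cs_projection (p B),
      [/\ p set0 = 0,
          forall B C, ug_sets B -> ug_sets C -> p B *c p C = p (B `&` C)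
        & forall B C, ug_sets B -> ug_sets C ->
            p (B `|` C) = p B + p C - p (B `&` C)],
      (forall e, (s e)^* *c s e = p (ug_rng e)) /\
        (forall e, cs_le (s e *c (s e)^*) (p [set ug_src e]))
    & forall v, X v ->
        p [set v] = \sum_(e \in [set e | ug_src e = v]) (s e *c (s e)^*)].

(* [A], with generators [s] and [p], is C*(G, X). *)
Definition is_ug_algebra (R : realType) (G : ultragraph)
    (X : set (ug_vertex G)) (A : cstarAlg R) (s : ug_edge G -> A)
    (p : set (ug_vertex G) -> A) : Prop :=
  ug_family X s p /\
  forall (B : cstarAlg R) (t : ug_edge G -> B) (q : set (ug_vertex G) -> B),
    ug_family X t q ->
    exists! phi : A -> B,
      [/\ star_hom phi,
          forall e, phi (s e) = t e
        & forall C, ug_sets C -> phi (p C) = q C].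

(* l^2(S) is represented by functions on [T] that vanish outside [S]. *)

Section ell2.
Variables (R : realType) (T : choiceType) (S : set T).

Definition sqsum (F : T -> R[i]) : \bar R :=
  \esum_(y in S) ((normc (F y)) ^+ 2)%:E.

Definition ell2_pred : {pred T -> R[i]} :=
  fun F => `[< (forall y, ~ S y -> F y = 0) /\ (sqsum F < +oo)%E >].

Fact ell2_submod : submod_closed ell2_pred.
Proof.
split.
  apply/asboolP; split=> // ; rewrite /sqsum esum1 // => y _.
  by rewrite normc0 expr0n.
move=> a F G /asboolP[F0 Fs] /asboolP[G0 Gs]; apply/asboolP; split.
  by move=> y Sy; rewrite !fctE F0 // G0 // scaler0 addr0.
have sq0 (H : T -> R[i]) : (0 <= sqsum H)%E.
  by apply: esum_ge0 => y _; rewrite lee_fin sqr_ge0.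
pose c : R := 2 * normc a ^+ 2.
have le1 (H : T -> R[i]) (k : R) : 0 <= k -> (sqsum H < +oo)%E ->
    (\esum_(y in S) (k * normc (H y) ^+ 2)%:E < +oo)%E.
  move=> k0 Hs; have Hf : sqsum H \is a fin_num by rewrite ge0_fin_numE.
  apply: (@le_lt_trans _ _ (k%:E * sqsum H)%E); last first.
    by rewrite -(fineK Hf) -EFinM ltry.
  apply: ub_ereal_sup => _ [D [Df DS] <-].
  rewrite (eq_fsbigr (fun y => k%:E * (normc (H y) ^+ 2)%:E)%E); last first.
    by move=> y _; rewrite EFinM.
  rewrite -ge0_mule_fsumr; last by move=> y; rewrite lee_fin sqr_ge0.
  apply: lee_wpmul2l; first by rewrite lee_fin.
  by apply: ereal_sup_ubound; exists D.
apply: (@le_lt_trans _ _ (\esum_(y in S)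
  ((c * normc (F y) ^+ 2)%:E + (2 * normc (G y) ^+ 2)%:E))%E).
  apply: le_esum => y _; rewrite -EFinD lee_fin !fctE.
  have := le_normcD (a *: F y) (G y); rewrite normcM => h.
  have nc0 (z : R[i]) : 0 <= normc z by case: z => ? ?; exact: sqrtr_ge0.
  apply: (@le_trans _ _ ((normc a * normc (F y) + normc (G y)) ^+ 2)).
    by rewrite ler_pXn2r // ?nnegrE // ?addr_ge0 // ?mulr_ge0.
  rewrite -subr_ge0 (_ : _ - _ = (normc a * normc (F y) - normc (G y)) ^+ 2).
    exact: sqr_ge0.
  by rewrite /c; ring.
have k0 (k : R) (z : R[i]) : 0 <= k -> 0 <= k * normc z ^+ 2.
  by move=> ?; apply: mulr_ge0 => //; exact: sqr_ge0.
rewrite esumD; last 2 first.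
- by move=> y _; rewrite lee_fin;
  apply: (k0 _ (F y)); apply: (k0 2 a).
- by move=> y _; rewrite lee_fin k0.
by apply: lte_add_pinfty; apply: le1 => //; exact: k0.
Qed.

HB.instance Definition _ := GRing.isSubmodClosed.Build _ _ ell2_pred ell2_submod.

Record ell2 := Ell2 { ell2_val :> T -> R[i]; _ : ell2_val \in ell2_pred }.

HB.instance Definition _ := [isSub for ell2_val].
HB.instance Definition _ := [Choice of ell2 by <:].
HB.instance Definition _ := [SubChoice_isSubLmodule of ell2 by <:].

(* Sum of an absolutely summable family of real, resp. complex, numbers. *)
Definition rsum (f : T -> R) : R :=
  fine (\esum_(y in S) (Num.max (f y) 0)%:E) -
  fine (\esum_(y in S) (Num.max (- f y) 0)%:E).

Definition csum (f : T -> R[i]) : R[i] :=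
  Complex (rsum (fun y => complex.Re (f y))) (rsum (fun y => complex.Im (f y))).

Definition inner (F G : ell2) : R[i] := csum (fun y => F y * conjc (G y)).

Definition ell2_norm (F : ell2) : R := Num.sqrt (fine (sqsum F)).

Definition bounded_op (L : ell2 -> ell2) : Prop :=
  linear L /\ exists M : R, forall F, ell2_norm (L F) <= M * ell2_norm F.

(* This is 0 when [y] is not in [S]. *)
Definition ell2_delta (y : T) : ell2 := insubd 0 (fun z => (z == y)%:R : R[i]).

Fact ell2_deltaE (y : T) :
  S y -> ell2_val (ell2_delta y) = (fun z => (z == y)%:R : R[i]).
Proof.
move=> Sy; rewrite -[ell2_val _]/(\val _) val_insubd ifT//.
apply/asboolP; split.
  by move=> z Sz; case: eqP => // zy; case: Sz; rewrite zy.
rewrite /sqsum (esumID [set y]); last by move=> *; rewrite lee_fin sqr_ge0.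
rewrite setIidr; last by move=> _ ->.
rewrite esum_set1; last by rewrite lee_fin sqr_ge0.
rewrite esum1 ?adde0 ?ltry// => z [_ /eqP/negbTE ->].
by rewrite normc0 expr0n.
Qed.

(* [rho] is a *-homomorphism from [A] to B(l^2(S)); the last clause says that
   [rho a^*] is the adjoint of [rho a]. *)
Definition star_rep (A : cstarAlg R) (rho : A -> ell2 -> ell2) : Prop :=
  [/\ forall a, bounded_op (rho a),
      forall a b F, rho (a + b) F = rho a F + rho b F,
      forall (z : R[i]) a F, rho (z *: a) F = z *: rho a F,
      forall a b F, rho (a *c b) F = rho a (rho b F)
    & forall a F G, inner (rho a F) G = inner F (rho a^* G)].

End ell2.

(* Indices start at 0: the closed intervals are [piece 0], [piece 1], etc.
   One-point intervals are allowed. *)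

Section markov.
Variables (R : realType) (a : R) (b : \bar R).
Variables (g : R -> R) (lo hi : nat -> R).

(* The interval [a, b[, with [b] possibly infinite. *)
Definition ambient : set R := [set y | a <= y /\ (y%:E < b)%E].

Definition piece (n : nat) : set R := `[lo n, hi n].

Definition gap (n : nat) : set R := `]hi n, lo n.+1[.

Definition mk_domain : set R := \bigcup_n piece n.

Definition bdpoints : set R := \bigcup_n (closure (piece n) `\` (piece n)°).

(* [g] is a partial map with domain [mk_domain]; the values of the total function
   [g] outside [mk_domain] are irrelevant. *)
Record markov_class : Prop := Markov {
  mk_le : forall n, lo n <= hi n;
  mk_ord : forall n, hi n <= lo n.+1;
  mk_sub1 : forall i j, i <> j -> is_subset1 (piece i `&` piece j);
  mk_domain_sub : mk_domain `<=` ambient;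
  mk_min : lo 0 = a;
  mk_sup : (hi n)%:E @[n --> \oo] --> b;
  mk_inj : forall i, set_inj (piece i)° g;
  mk_im : g @` mk_domain `<=` ambient;
  mk_bd : g @` bdpoints `<=` bdpoints;
  mk_union : forall i, exists N : set nat,
    N !=set0 /\ g @` piece i `&` mk_domain = \bigcup_(n in N) piece n
}.

Definition mk_rng (i : nat) : set nat :=
  [set j | (piece j)° `<=` g @` (piece i)°].

Definition markov_ultragraph : ultragraph := @Ultragraph nat nat id mk_rng.

(* The domain of the [n]-th iterate of the partial map [g]. *)
Definition iter_dom (n : nat) : set R :=
  [set y | forall k, (k < n)%N -> mk_domain (iter k g y)].

Definition escaping : set R :=
  [set y | exists k, [/\ (0 < k)%N, iter_dom k y
                       & exists j, gap j (iter k g y)]].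

Definition escape_time (y : R) : nat :=
  xget 0%N [set t | [/\ (0 < t)%N, iter_dom t y & ~ mk_domain (iter t g y)]].

Definition escape_point (y : R) : R := iter (escape_time y) g y.

Definition orbit_set (x : R) : set R :=
  [set y | mk_domain y /\ exists n, [/\ (0 < n)%N, iter_dom n y
                                & iter n g y = escape_point x]].

(* The value at [y] of the inverse of the restriction of [g] to [piece i]. *)
Definition ginv (i : nat) (y : R) : R :=
  xget y [set z | piece i z /\ g z = y].

Let G := markov_ultragraph.
Variable x : R.
Let S := orbit_set x.

Definition pieces (B : set nat) : set R := \bigcup_(j in B) piece j.

Definition is_W (B : set nat) (W : ell2 R S -> ell2 R S) : Prop :=
  bounded_op W /\
  forall y, S y -> W (ell2_delta R S y) = \1_(pieces B) y *: ell2_delta R S y.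

Definition is_T (i : nat) (W : ell2 R S -> ell2 R S) : Prop :=
  bounded_op W /\
  forall y, S y ->
    W (ell2_delta R S y) = \1_(pieces (mk_rng i)) y *: ell2_delta R S (ginv i y).

Definition bs_D (B : set nat) : set R := \bigcup_(j in B) (piece j `&` S).

Definition bs_R (i : nat) : set R :=
  \bigcup_(j in mk_rng i)
     (piece i `&` g @^-1` (piece j `&` S)).

Definition is_nu (A : cstarAlg R) (s : nat -> A) (p : set nat -> A)
    (nu : A -> ell2 R S -> ell2 R S) : Prop :=
  [/\ star_rep nu,
      forall B, @ug_sets G B -> is_W B (nu (p B))
    & forall i, is_T i (nu (s i))].

(* The representation induced by the branching system with sets [bs_D], [bs_R]
   and maps f_i := ginv i from [bs_D (mk_rng i)] to [bs_R i]. The inverse of f_i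
   is the restriction of [g] to [bs_R i], and there is no Radon-Nikodym factor
   since the measure is the counting measure. *)
Definition is_pi (A : cstarAlg R) (s : nat -> A) (p : set nat -> A)
    (pi : A -> ell2 R S -> ell2 R S) : Prop :=
  [/\ star_rep pi,
      forall B, @ug_sets G B -> forall F y,
        pi (p B) F y = \1_(bs_D B) y * F y
    & forall i F y, pi (s i) F y = \1_(bs_R i) y * F (g y)].

End markov.

Arguments is_nu {R} g lo hi x {A} s p nu.
Arguments is_pi {R} g lo hi x {A} s p pi.

(* Main.v *)
Require Import Defs.
From HB Require Import structures.
From mathcomp Require Import all_boot all_order all_algebra.
From mathcomp Require Import complex.
From mathcomp Require Import all_classical all_reals all_analysis.
From mathcomp Require Import ring lra.

Set Implicit Arguments.
Unset Strict Implicit.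
Unset Printing Implicit Defensive.

Import Order.TTheory GRing.Theory Num.Theory.
Import numFieldNormedType.Exports.
Import ComplexField.Normc.

Local Open Scope classical_set_scope.
Local Open Scope ring_scope.

(** Two representations of C*(G,X) that agree on the generators are equal, by
    the uniqueness part of the universal property. So everything reduces to one
    operator computation: on basis vectors, [W_B] and [T_(e_i)] are the
    operators that the branching system prescribes, namely multiplication by the
    indicator of [D_B] and the partial isometry that transports functions along
    the bijection [g : R_(e_i) -> D_(r(e_i))] (lemmas [vertex_op_is_W] and
    [edge_op_is_T]). A bounded operator is determined by its values on the
    basis (lemma [bop_delta_ext]), which turns agreement on basis vectors into
    equality of operators.

    To use the universal property, both for existence and for uniqueness, the
    target has to be an actual C*-algebra. The first half of the file therefore
    builds B(l^2(S)) for an arbitrary set S: the inner product and its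
    Cauchy-Schwarz inequality, completeness of l^2(S), and the algebra
    [bop_cstar] of bounded operators that have an adjoint, with the operator
    norm. By Riesz every bounded operator on a Hilbert space has an adjoint, so
    this is all of B(l^2(S)); taking the adjoint as part of the definition
    makes linearity automatic and the involution immediate. A *-representation
    on l^2(S) is then the same thing as a *-homomorphism into [bop_cstar]
    (lemmas [star_hom_rep] and [star_rep_hom]).

    The second half checks the defining relations of C*(G,X)
    ([vertex_edge_family]). They hold because the backward orbit S of the escape
    point never meets an endpoint of a piece: endpoints stay endpoints under g,
    hence never escape (lemma [orbit_not_bdpoint]). So every point of S lies in
    the interior of exactly one piece, and on those interiors g is injective.
    The relation at a vertex [v_i] of X needs in addition that every point of S
    in the i-th piece be mapped into some piece indexed by r(e_i). Such a point
    is either mapped to another point of S, and then the Markov property puts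
    its image in such a piece, or straight to the escape point; the hypothesis
    on X excludes the latter (lemma [bs_D_cover]). *)

(** * Moduli of complex numbers *)

Section complex_facts.
Variable R : realType.
Implicit Types z w : R[i].

Lemma normc_nonneg z : 0 <= normc z.
Proof. by case: z => a b; exact: sqrtr_ge0. Qed.

Lemma sqr_normcE z : normc z ^+ 2 = complex.Re z ^+ 2 + complex.Im z ^+ 2.
Proof. by case: z => a b /=; rewrite sqr_sqrtr// addr_ge0// sqr_ge0. Qed.

Lemma normc_conj z : normc (conjc z) = normc z.
Proof. by case: z => a b /=; rewrite sqrrN. Qed.

Lemma mulcJ z : z * conjc z = (normc z ^+ 2)%:C%C.
Proof.
rewrite sqr_normcE; case: z => a b /=; apply/eqP.
by rewrite eq_complex /=; apply/andP; split; apply/eqP; ring.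
Qed.

Lemma le_Re_normc z : `|complex.Re z| <= normc z.
Proof. by have := normc_ge_Re z; rewrite /Num.norm/= lecR. Qed.

Lemma le_Im_normc z : `|complex.Im z| <= normc z.
Proof.
rewrite -(ler_pXn2r (n := 2)) ?nnegrE ?normc_nonneg// real_normK ?num_real//.
by rewrite sqr_normcE lerDr sqr_ge0.
Qed.

Lemma complexReD z w : complex.Re (z + w) = complex.Re z + complex.Re w.
Proof. by case: z; case: w. Qed.

Lemma complexImD z w : complex.Im (z + w) = complex.Im z + complex.Im w.
Proof. by case: z; case: w. Qed.

Lemma complexReM z w :
  complex.Re (z * w) = complex.Re z * complex.Re w - complex.Im z * complex.Im w.
Proof. by case: z; case: w. Qed.

Lemma complexImM z w :
  complex.Im (z * w) = complex.Re z * complex.Im w + complex.Im z * complex.Re w.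
Proof. by case: z; case: w. Qed.

Lemma conjcD z w : conjc (z + w) = conjc z + conjc w.
Proof. exact: rmorphD. Qed.

Lemma conjcM z w : conjc (z * w) = conjc z * conjc w.
Proof. exact: rmorphM. Qed.

Lemma conjcN z : conjc (- z) = - conjc z.
Proof. exact: rmorphN. Qed.

End complex_facts.

(** * Absolutely summable families *)

Section sums.
Variables (R : realType) (T : choiceType) (S : set T).
Implicit Types f h : T -> R.

Let max0_ge0 (r : R) : 0 <= Num.max r 0.
Proof. by rewrite le_max lexx orbT. Qed.
#[local] Hint Resolve max0_ge0 : core.

Definition asum f := (\esum_(y in S) (`|f y|)%:E < +oo)%E.

Lemma le_asum f h : asum h -> (forall y, S y -> `|f y| <= `|h y|) -> asum f.
Proof.
by move=> sh fh; apply: le_lt_trans sh; apply: le_esum => y Sy; rewrite lee_fin fh.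
Qed.

Lemma esum_fin f : asum f -> (forall y, 0 <= f y) ->
  (\esum_(y in S) (f y)%:E \is a fin_num)%E.
Proof.
move=> sf f0; rewrite ge0_fin_numE; last first.
  by apply: esum_ge0 => y _; rewrite lee_fin.
by apply: le_lt_trans sf; apply: le_esum => y _; rewrite lee_fin ler_norm.
Qed.

Lemma asumD f h : asum f -> asum h -> asum (f \+ h).
Proof.
move=> sf sh; apply: le_lt_trans (lte_add_pinfty sf sh).
rewrite -esumD//.
by apply: le_esum => y _; rewrite -EFinD lee_fin ler_normD.
Qed.

(** Scaling each finite sum gives one inequality; the other one is the same
    inequality for the factor c^-1. *)
Lemma esumZ c f : 0 <= c -> (forall y, 0 <= f y) ->
  (\esum_(y in S) (c * f y)%:E = c%:E * \esum_(y in S) (f y)%:E)%E.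
Proof.
have le1 k h : 0 <= k -> (forall y, 0 <= h y) ->
    (\esum_(y in S) (k * h y)%:E <= k%:E * \esum_(y in S) (h y)%:E)%E.
  move=> k0 h0; apply: ge_ereal_sup => _ [D [Df DS] <-].
  rewrite (eq_fsbigr (fun y => k%:E * (h y)%:E)%E); last first.
    by move=> y _; rewrite EFinM.
  rewrite -ge0_mule_fsumr; last by move=> y; rewrite lee_fin.
  apply: lee_wpmul2l; first by rewrite lee_fin.
  by apply: ereal_sup_ubound; exists D.
move=> c0 f0; apply/eqP; rewrite eq_le le1//=.
have [->|cn0] := eqVneq c 0; last have {cn0}c0 : 0 < c by rewrite lt_def cn0.
  by rewrite mul0e; apply: esum_ge0 => y _; rewrite mul0r.
have /= := le1 c^-1 (fun y => c * f y).
rewrite invr_ge0 (ltW c0) => /(_ erefl (fun y => mulr_ge0 (ltW c0) (f0 y))).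
rewrite (_ : (fun y => _) = (fun y => (f y)%:E)); last first.
  by apply/funext => y; rewrite mulKf// gt_eqF.
move=> h; have := lee_wpmul2l _ h => /(_ c%:E); rewrite lee_fin (ltW c0).
move=> /(_ erefl) /le_trans; apply.
by rewrite muleA -EFinM divff ?gt_eqF// mul1e.
Qed.

Lemma asumZ c f : asum f -> asum (fun y => c * f y).
Proof.
move=> sf; rewrite /asum (_ : (fun y => _) = (fun y => (`|c| * `|f y|)%:E)).
  rewrite esumZ//.
  have /fineK <- : (\esum_(y in S) (`|f y|)%:E)%E \is a fin_num.
    by apply: esum_fin => //; apply: le_asum sf _ => y _; rewrite normr_id.
  by rewrite -EFinM ltry.
by apply/funext => y; rewrite normrM.
Qed.

Lemma asumN f : asum f -> asum (fun y => - f y).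
Proof. by apply: le_lt_trans; apply: le_esum => y _; rewrite normrN. Qed.

Definition fsum f := fine (\esum_(y in S) (f y)%:E)%E.

Lemma fsum_ge0 f : (forall y, S y -> 0 <= f y) -> 0 <= fsum f.
Proof. by move=> f0; apply/fine_ge0/esum_ge0 => y Sy; rewrite lee_fin f0. Qed.

Lemma fsumD f h : asum f -> asum h ->
  (forall y, 0 <= f y) -> (forall y, 0 <= h y) ->
  fsum (fun y => f y + h y) = fsum f + fsum h.
Proof.
move=> sf sh f0 h0; rewrite /fsum -fineD ?esum_fin//; congr fine.
by rewrite -esumD// => y _; rewrite lee_fin.
Qed.

Lemma fsumZ c f : asum f -> 0 <= c -> (forall y, 0 <= f y) ->
  fsum (fun y => c * f y) = c * fsum f.
Proof.
by move=> sf c0 f0; rewrite /fsum esumZ// fineM// ?esum_fin.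
Qed.

Local Notation rs := (@rsum R T S).

Lemma rsumE f : rs f = fsum (fun y => Num.max (f y) 0)
                       - fsum (fun y => Num.max (- f y) 0).
Proof. by []. Qed.

Lemma asum_pos f : asum f -> asum (fun y => Num.max (f y) 0).
Proof.
apply: le_lt_trans; apply: le_esum => y _; rewrite lee_fin.
by case: (leP (f y) 0) => //; rewrite normr0.
Qed.

(** The value does not depend on how the family is written as a difference of
    nonnegative ones, since two such decompositions [f - h] and [p - n]
    satisfy [p + h = n + f] termwise. Additivity of [rsum] reduces to
    this. *)
Lemma rsumB f h : asum f -> asum h ->
  (forall y, 0 <= f y) -> (forall y, 0 <= h y) ->
  rs (fun y => f y - h y) = fsum f - fsum h.
Proof.
move=> sf sh f0 h0.
have sd : asum (fun y => f y - h y) by exact: asumD (asumN sh).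
have sp := asum_pos sd; have sn := asum_pos (asumN sd).
rewrite rsumE; set p := fsum _; set n := fsum _.
suff : p + fsum h = n + fsum f by lra.
rewrite /p /n -!fsumD//; congr fsum; apply/funext => y /=.
by case: (leP (f y - h y)) => ?; case: (leP (- (f y - h y))) => ?; lra.
Qed.

Lemma rsumD f h : asum f -> asum h -> rs (fun y => f y + h y) = rs f + rs h.
Proof.
move=> sf sh.
rewrite !rsumE; have sfN := asumN sf; have shN := asumN sh.
have /asum_pos sp := sf; have /asum_pos sn := sfN.
have /asum_pos tp := sh; have /asum_pos tn := shN.
have := rsumB (asumD sp tp) (asumD sn tn).
rewrite fsumD// fsumD// => E.
have -> : forall a b c d : R, a - b + (c - d) = a + c - (b + d).
  by move=> *; ring.
rewrite -E; [|by move=> y; rewrite addr_ge0..].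
rewrite -rsumE; congr rsum; apply/funext => y /=.
by case: (leP (f y)) => ?; case: (leP (h y)) => ?;
   case: (leP (- f y)) => ?; case: (leP (- h y)) => ?; lra.
Qed.

Lemma rsumN f : rs (fun y => - f y) = - rs f.
Proof.
rewrite !rsumE opprB; congr (_ - _); congr fsum; apply/funext => y.
by rewrite opprK.
Qed.

Lemma rsumZ c f : asum f -> rs (fun y => c * f y) = c * rs f.
Proof.
wlog c0 : c / 0 <= c => [hw sf|sf].
  have [/hw/(_ sf)//|c0] := leP 0 c.
  rewrite (_ : (fun y => _) = (fun y => - (- c * f y))).
    by rewrite rsumN hw// ?mulNr ?opprK// oppr_ge0 ltW.
  by apply/funext => y; rewrite mulNr opprK.
have /asum_pos sp := sf; have /asum_pos sn := asumN sf.
rewrite !rsumE mulrBr -(fsumZ sp)// -(fsumZ sn)//.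
by congr (_ - _); congr fsum; apply/funext => y; rewrite maxr_pMr ?mulr0 ?mulrN.
Qed.

Lemma ge0_rsum f : (forall y, 0 <= f y) -> rs f = fsum f.
Proof.
move=> f0; rewrite rsumE [X in _ - X](_ : _ = 0) ?subr0.
  by congr fsum; apply/funext => y; rewrite max_l.
by rewrite /fsum esum1// => y _; rewrite max_r// oppr_le0.
Qed.

Lemma eq_rsum f h : (forall y, S y -> f y = h y) -> rs f = rs h.
Proof.
by move=> fh; rewrite !rsumE /fsum; congr (fine _ - fine _);
  apply: eq_esum => y Sy; rewrite fh.
Qed.

End sums.

Section complex_sums.
Variables (R : realType) (T : choiceType) (S : set T).
Implicit Types f h : T -> R[i].

Definition casum f := asum S (fun y => normc (f y)).

Local Notation cs := (@csum R T S).

Lemma casum_Re f : casum f -> asum S (fun y => complex.Re (f y)).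
Proof.
move=> sf; apply: le_asum sf _ => y _.
by rewrite (ger0_norm (normc_nonneg _)) le_Re_normc.
Qed.

Lemma casum_Im f : casum f -> asum S (fun y => complex.Im (f y)).
Proof.
move=> sf; apply: le_asum sf _ => y _.
by rewrite (ger0_norm (normc_nonneg _)) le_Im_normc.
Qed.

Lemma csumD f h : casum f -> casum h -> cs (fun y => f y + h y) = cs f + cs h.
Proof.
move=> sf sh; apply/eqP; rewrite eq_complex /= -!rsumD; last 4 first.
- exact: casum_Im.
- exact: casum_Im.
- exact: casum_Re.
- exact: casum_Re.
apply/andP; split; apply/eqP; apply: eq_rsum => y _; first by rewrite complexReD.
by rewrite complexImD.
Qed.

Lemma csumZ z f : casum f -> cs (fun y => z * f y) = z * cs f.
Proof.
move=> sf; have sR := casum_Re sf; have sI := casum_Im sf.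
apply/eqP; rewrite eq_complex; apply/andP; split; apply/eqP.
  rewrite complexReM /= -mulNr -!rsumZ// -rsumD; last 2 first.
  - exact: asumZ.
  - exact: asumZ.
  by apply: eq_rsum => y _; rewrite complexReM mulNr.
rewrite complexImM /= -!rsumZ// -rsumD; last 2 first.
- exact: asumZ.
- exact: asumZ.
by apply: eq_rsum => y _; rewrite complexImM.
Qed.

Lemma csumJ f : cs (fun y => conjc (f y)) = conjc (cs f).
Proof.
rewrite /csum /= -rsumN; congr Complex; apply: eq_rsum => y _.
  by case: (f y).
by case: (f y).
Qed.

Lemma eq_csum f h : (forall y, S y -> f y = h y) -> cs f = cs h.
Proof.
by move=> fh; congr Complex; apply: eq_rsum => y Sy; rewrite fh.
Qed.

End complex_sums.

(** * The inner product of l^2 *)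

Section inner_product.
Variables (R : realType) (T : choiceType) (S : set T).
Local Notation H := (ell2 R S).
Implicit Types F G K : H.

Lemma ell2_memP (F : T -> R[i]) :
  reflect ((forall y, ~ S y -> F y = 0) /\ asum S (fun y => normc (F y) ^+ 2))
          (F \in @ell2_pred R T S).
Proof.
have E : sqsum S F = (\esum_(y in S) (`|normc (F y) ^+ 2|)%:E)%E.
  by apply: eq_esum => y _; rewrite ger0_norm// sqr_ge0.
by rewrite /asum -E; exact: asboolP.
Qed.

Lemma ell2_out F y : ~ S y -> F y = 0.
Proof. by move: y; have /ell2_memP[] := valP F. Qed.

Lemma ell2_asum F : asum S (fun y => normc (F y) ^+ 2).
Proof. by have /ell2_memP[] := valP F. Qed.

Lemma ell2P F G : (forall y, S y -> F y = G y) -> F = G.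
Proof.
move=> FG; apply/val_inj/funext => y /=; have [/FG//|nS] := pselect (S y).
by rewrite !ell2_out.
Qed.

Lemma ell2D F G y : (F + G) y = F y + G y. Proof. by []. Qed.
Lemma ell2Z z F y : (z *: F) y = z * F y. Proof. by []. Qed.
Lemma ell2N F y : (- F) y = - F y. Proof. by []. Qed.
(** Termwise, 2|st| is at most |s|^2 + |t|^2. *)
Lemma inner_casum F G : casum S (fun y => F y * conjc (G y)).
Proof.
apply: le_asum (asumD (ell2_asum F) (ell2_asum G)) _ => y _ /=.
rewrite normcM normc_conj !ger0_norm ?mulr_ge0 ?addr_ge0 ?normc_nonneg ?sqr_ge0//.
have := normc_nonneg (F y); have := normc_nonneg (G y).
set s := normc _; set t := normc _ => s0 t0.
have := sqr_ge0 (s - t); have := mulr_ge0 s0 t0; lra.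
Qed.

Lemma innerDl F G K : inner (F + G) K = inner F K + inner G K.
Proof.
rewrite /inner -csumD; try exact: inner_casum.
by apply: eq_csum => y _; rewrite -mulrDl.
Qed.

Lemma innerZl z F G : inner (z *: F) G = z * inner F G.
Proof.
rewrite /inner -csumZ; last exact: inner_casum.
by apply: eq_csum => y _; rewrite mulrA.
Qed.

Lemma innerJ F G : inner G F = conjc (inner F G).
Proof.
rewrite /inner -csumJ; apply: eq_csum => y _.
by rewrite conjcM conjcK mulrC.
Qed.

Lemma innerDr F G K : inner F (G + K) = inner F G + inner F K.
Proof. by rewrite innerJ innerDl conjcD -!innerJ. Qed.

Lemma innerZr z F G : inner F (z *: G) = conjc z * inner F G.
Proof. by rewrite innerJ innerZl conjcM -!innerJ. Qed.

Lemma inner0l F : inner 0 F = 0.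
Proof. by rewrite -(scale0r 0) innerZl mul0r. Qed.

Lemma inner0r F : inner F 0 = 0.
Proof. by rewrite innerJ inner0l conjc0. Qed.

Lemma innerNl F G : inner (- F) G = - inner F G.
Proof. by rewrite -scaleN1r innerZl mulN1r. Qed.

Lemma innerNr F G : inner F (- G) = - inner F G.
Proof. by rewrite innerJ innerNl conjcN -innerJ. Qed.

Lemma innerBl F G K : inner (F - G) K = inner F K - inner G K.
Proof. by rewrite innerDl innerNl. Qed.

Lemma innerBr F G K : inner F (G - K) = inner F G - inner F K.
Proof. by rewrite innerDr innerNr. Qed.

Local Notation N := (@ell2_norm R T S).

Lemma ell2_norm_ge0 F : 0 <= N F.
Proof. exact: sqrtr_ge0. Qed.

Lemma sqr_ell2_norm F : N F ^+ 2 = fsum S (fun y => normc (F y) ^+ 2).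
Proof. by rewrite sqr_sqrtr// fsum_ge0// => y _; exact: sqr_ge0. Qed.

Lemma inner_norm F : inner F F = (N F ^+ 2)%:C%C.
Proof.
rewrite sqr_ell2_norm /inner /csum; congr Complex.
  rewrite -ge0_rsum; last by move=> y; exact: sqr_ge0.
  by apply: eq_rsum => y _; rewrite mulcJ.
rewrite (@eq_rsum _ _ _ _ (fun=> 0)); last by move=> y _; rewrite mulcJ.
by rewrite ge0_rsum// /fsum esum1.
Qed.

(** Evaluation at a point is a contraction, so norm convergence implies
    pointwise convergence. *)
Lemma le_normc_norm F y : normc (F y) <= N F.
Proof.
have [Sy|nS] := pselect (S y); last first.
  by rewrite ell2_out// normc0 ell2_norm_ge0.
rewrite -(ler_pXn2r (n := 2)) ?nnegrE ?ell2_norm_ge0 ?normc_nonneg//.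
rewrite sqr_ell2_norm.
have -> : normc (F y) ^+ 2 = fsum [set y] (fun y => normc (F y) ^+ 2).
  by rewrite /fsum esum_set1// lee_fin sqr_ge0.
rewrite /fsum fine_le//.
- by rewrite esum_set1// lee_fin sqr_ge0.
- by apply: esum_fin (ell2_asum F) _ => z; exact: sqr_ge0.
- rewrite (esumID [set y] S); last by move=> z _; rewrite lee_fin sqr_ge0.
  rewrite setIidr; last by move=> _ ->.
  by rewrite leeDl// esum_ge0// => z _; rewrite lee_fin sqr_ge0.
Qed.

Lemma ell2_norm_eq0 F : N F = 0 -> F = 0.
Proof.
move=> F0; apply: ell2P => y _; apply: eq0_normc; apply/eqP.
by rewrite eq_le normc_nonneg -F0 le_normc_norm.
Qed.

Lemma ell2_norm0 : N 0 = 0.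
Proof.
have /eqP := inner_norm 0; rewrite inner0l eq_sym => /eqP [/eqP].
by rewrite sqrf_eq0 => /eqP.
Qed.

Lemma ell2_normZ z F : N (z *: F) = normc z * N F.
Proof.
apply/eqP; rewrite -(eqrXn2 (n := 2)) ?mulr_ge0 ?ell2_norm_ge0 ?normc_nonneg//.
rewrite exprMn !sqr_ell2_norm -fsumZ ?sqr_ge0//; last 2 first.
- exact: ell2_asum.
- by move=> y; exact: sqr_ge0.
by apply/eqP; congr fsum; apply/funext => y; rewrite ell2Z normcM exprMn.
Qed.

Lemma ell2_normN F : N (- F) = N F.
Proof. by rewrite -scaleN1r ell2_normZ normcN normc1 mul1r. Qed.

(** The squared norm of |G|^2 F - (F, G) G expands to |G|^2 (|F|^2 |G|^2 -
    |(F, G)|^2), and it is nonnegative. *)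
Lemma cauchy_schwarz F G : normc (inner F G) <= N F * N G.
Proof.
have [G0|G0] := eqVneq (N G) 0.
  by rewrite (ell2_norm_eq0 G0) inner0r normc0 ell2_norm0 mulr0.
have nG : 0 < N G ^+ 2 by rewrite exprn_gt0// lt_def G0 ell2_norm_ge0.
set c := inner F G; set d : R[i] := (N G ^+ 2)%:C%C.
(* Scaling by |G|^2 instead of dividing by it keeps the expansion polynomial. *)
pose K := d *: F - c *: G.
have : inner K K = (N G ^+ 2 * (N F ^+ 2 * N G ^+ 2 - normc c ^+ 2))%:C%C.
  rewrite /K !innerBl !innerBr !innerZl !innerZr !inner_norm -/c.
  rewrite (innerJ F G) -/c conjc_real -/d.
  transitivity (d * ((N F ^+ 2)%:C%C * d - c * conjc c)); first by ring.
  by rewrite mulcJ -rmorphM -rmorphB -rmorphM.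
rewrite inner_norm => -[] /esym E.
have := sqr_ge0 (N K); rewrite -E pmulr_rge0// subr_ge0 -exprMn.
by rewrite ler_pXn2r// nnegrE ?mulr_ge0 ?ell2_norm_ge0 ?normc_nonneg.
Qed.

Lemma ell2_normD F G : N (F + G) <= N F + N G.
Proof.
rewrite -(ler_pXn2r (n := 2)) ?nnegrE ?addr_ge0 ?ell2_norm_ge0//.
have E : N (F + G) ^+ 2 = N F ^+ 2 + N G ^+ 2 + 2 * complex.Re (inner F G).
  have := inner_norm (F + G); rewrite innerDl !innerDr !inner_norm.
  rewrite (innerJ F G); case: (inner F G) => a b [<-] _ /=; ring.
have h : complex.Re (inner F G) <= N F * N G.
  apply: le_trans (cauchy_schwarz F G); apply: le_trans (le_Re_normc _).
  exact: ler_norm.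
rewrite E; lra.
Qed.

Lemma ell2_distC F G : N (F - G) = N (G - F).
Proof. by rewrite -ell2_normN opprB. Qed.

Lemma inner_ext F G : (forall K, inner K F = inner K G) -> F = G.
Proof.
move=> FG; apply/eqP; rewrite -subr_eq0; apply/eqP/ell2_norm_eq0/eqP.
rewrite -(@sqrf_eq0 R); have /eqP := inner_norm (F - G).
by rewrite innerBr FG subrr eq_sym => /eqP [->].
Qed.

Local Notation delta := (@ell2_delta R T S).

(** Coordinates are inner products with basis vectors; this is how an adjoint
    is read off from the values of an operator on the basis. *)
Lemma inner_delta F y : S y -> inner F (delta y) = F y.
Proof.
move=> Sy; rewrite /inner ell2_deltaE//.
have rs1 (f : T -> R) : (forall z, z != y -> f z = 0) ->
    rsum S f = f y.
  move=> f0; rewrite rsumE.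
  have fs1 (u : T -> R) : 0 <= u y -> (forall z, z != y -> u z = 0) ->
      fsum S u = u y.
    move=> uy u0; rewrite /fsum (esumID [set y]); last first.
      move=> z _; rewrite lee_fin; have [->//|/u0->//] := eqVneq z y.
    rewrite setIidr; last by move=> _ ->.
    rewrite esum_set1 ?lee_fin// esum1 ?adde0//.
    by move=> z [_ /= /eqP/u0 ->].
  rewrite !fs1.
  - by case: (leP (f y)); case: (leP (- f y)) => ? ?; lra.
  - by rewrite le_max lexx orbT.
  - by move=> z /f0 ->; rewrite oppr0 maxxx.
  - by rewrite le_max lexx orbT.
  - by move=> z /f0 ->; rewrite maxxx.
rewrite /csum !rs1.
- by rewrite eqxx conjc1 mulr1; case: (F y).
- by move=> z /negbTE ->; rewrite conjc0 mulr0.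
- by move=> z /negbTE ->; rewrite conjc0 mulr0.
Qed.

End inner_product.

(** * Completeness of l^2 *)

Section ell2_completeness.
Variables (R : realType) (T : choiceType) (S : set T).
Local Notation H := (ell2 R S).
Local Notation N := (@ell2_norm R T S).

Lemma fin_sum_le_fsum (f : T -> R) (D : set T) :
  asum S f -> (forall y, 0 <= f y) -> finite_set D -> D `<=` S ->
  \sum_(y \in D) f y <= fsum S f.
Proof.
move=> sf f0 Df DS; rewrite -lee_fin -fsumEFin// /fsum fineK ?esum_fin//.
by apply: ereal_sup_ubound; exists D.
Qed.

Lemma fin_sums_bounded (f : T -> R) (c : R) :
  (forall y, 0 <= f y) ->
  (forall D, finite_set D -> D `<=` S -> \sum_(y \in D) f y <= c) ->
  asum S f /\ fsum S f <= c.
Proof.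
move=> f0 fc.
have le : (\esum_(y in S) (f y)%:E <= c%:E)%E.
  by apply: ge_ereal_sup => _ [D [Df DS] <-]; rewrite fsumEFin// lee_fin fc.
have sf : asum S f.
  apply: le_lt_trans (ltry c); apply: le_trans le.
  by apply: le_esum => y _; rewrite ger0_norm.
by split=> //; rewrite -lee_fin /fsum fineK ?esum_fin.
Qed.

Section limit.
Variables (I : Type) (X : set_system I) (PX : ProperFilter X) (u : I -> H).
Hypothesis u_cauchy : forall e : R, 0 < e ->
  exists i, \forall j \near X, N (u j - u i) <= e.

Lemma coord_cvg (p : R[i] -> R) y :
  (forall z w, p (z - w) = p z - p w) -> (forall z, `|p z| <= normc z) ->
  cvg ((fun j => p (u j y)) @ X).
Proof.
move=> pB pn; apply: cauchy_cvg; apply: cauchy_exP => e e0.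
have e2 : 0 < e / 2 by rewrite divr_gt0.
have [i iX] := u_cauchy e2; exists (p (u i y)).
rewrite nbhs_simpl /=; apply: filterS iX => j uij.
rewrite -ball_normE /= -pB (le_lt_trans (pn _))//.
rewrite (_ : u i y - u j y = (u i - u j) y)// (le_lt_trans (le_normc_norm _ _))//.
by rewrite ell2_distC (le_lt_trans uij)// ltr_pdivrMr// ltr_pMr// ltr1n.
Qed.

Let Re_cvg y : cvg ((fun j => complex.Re (u j y)) @ X).
Proof.
apply: coord_cvg; last exact: le_Re_normc.
by move=> [a b] [c d].
Qed.

Let Im_cvg y : cvg ((fun j => complex.Im (u j y)) @ X).
Proof.
apply: coord_cvg; last exact: le_Im_normc.
by move=> [a b] [c d].
Qed.

Let lim_val y : R[i] :=
  Complex (lim ((fun j => complex.Re (u j y)) @ X))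
          (lim ((fun j => complex.Im (u j y)) @ X)).

(* A finite sum of squared distances to the limit is the limit of such sums,
   each of which is bounded by the square of a distance in l^2. *)
Let fatou (e : R) i D : 0 <= e -> (\forall j \near X, N (u j - u i) <= e) ->
  finite_set D -> D `<=` S ->
  \sum_(y \in D) normc (u i y - lim_val y) ^+ 2 <= e ^+ 2.
Proof.
move=> e0 iX Df DS.
pose q (y : T) (j : I) : R := (complex.Re (u i y) - complex.Re (u j y)) ^+ 2 +
  (complex.Im (u i y) - complex.Im (u j y)) ^+ 2.
have qE y j : q y j = normc ((u j - u i) y) ^+ 2.
  rewrite -normcN -ell2N opprB sqr_normcE /q.
  by rewrite (_ : (u i - u j) y = u i y - u j y)//; case: (u i y); case: (u j y).
rewrite fsbig_finite//=.
apply: (@cvgr_to_le _ _ PX _ (fun j => \sum_(y <- finmap.enum_fset (fset_set D)) q y j)); last first.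
  apply: filterS iX => j uij.
  under eq_bigr do rewrite qE.
  rewrite -fsbig_finite//=.
  apply: (@le_trans _ _ (N (u j - u i) ^+ 2)).
    rewrite [leRHS]sqr_ell2_norm.
    have s0 y : 0 <= normc ((u j - u i) y) ^+ 2 by exact: sqr_ge0.
    exact: (fin_sum_le_fsum (ell2_asum (u j - u i)) s0 Df DS).
  by rewrite ler_pXn2r// nnegrE ell2_norm_ge0.
apply: cvg_big => [|y _]; first exact: add_continuous.
rewrite sqr_normcE.
have -> : complex.Re (u i y - lim_val y) = complex.Re (u i y) -
    lim ((fun j => complex.Re (u j y)) @ X) by case: (u i y).
have -> : complex.Im (u i y - lim_val y) = complex.Im (u i y) -
    lim ((fun j => complex.Im (u j y)) @ X) by case: (u i y).
rewrite !expr2 /q.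
under eq_cvg do rewrite !expr2.
have cR : complex.Re (u i y) - complex.Re (u j y) @[j --> X] -->
    complex.Re (u i y) - lim ((fun j => complex.Re (u j y)) @ X).
  by apply: cvgB; [exact: cvg_cst|exact: Re_cvg].
have cI : complex.Im (u i y) - complex.Im (u j y) @[j --> X] -->
    complex.Im (u i y) - lim ((fun j => complex.Im (u j y)) @ X).
  by apply: cvgB; [exact: cvg_cst|exact: Im_cvg].
exact: (cvgD (cvgM cR cR) (cvgM cI cI)).
Qed.

Lemma ell2_complete :
  exists F : H, forall e : R, 0 < e -> \forall j \near X, N (u j - F) <= e.
Proof.
have diff_mem e i : 0 <= e -> (\forall j \near X, N (u j - u i) <= e) ->
    ((fun y => u i y - lim_val y) \in @ell2_pred R T S) /\
    fsum S (fun y => normc (u i y - lim_val y) ^+ 2) <= e ^+ 2.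
  move=> e0 iX.
  have [] := @fin_sums_bounded (fun y => normc (u i y - lim_val y) ^+ 2) (e ^+ 2).
  - by move=> y; exact: sqr_ge0.
  - by move=> D Df DS; exact: fatou.
  move=> sd le; split => //; apply/ell2_memP; split=> // y nS.
  rewrite ell2_out// sub0r /lim_val.
  rewrite (_ : (fun j => complex.Re (u j y)) = fun=> 0); last first.
    by apply/funext => j; rewrite ell2_out.
  rewrite (_ : (fun j => complex.Im (u j y)) = fun=> 0); last first.
    by apply/funext => j; rewrite ell2_out.
  by rewrite !lim_cst// -[RHS]oppr0.
have [i0 i0X] := u_cauchy ltr01.
have [m0 _] := diff_mem _ _ ler01 i0X.
(* The pointwise limit is in l^2 because it differs from some term of the
   family by an element of l^2. *)
pose F : H := u i0 - Ell2 m0.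
have FE y : F y = lim_val y.
  rewrite /F -[LHS]/(u i0 y - (u i0 y - lim_val y)); ring.
exists F => e e0.
have e2 : 0 < e / 2 by rewrite divr_gt0.
have [i iX] := u_cauchy e2.
have [_ ile] := diff_mem _ _ (ltW e2) iX.
have iF : N (u i - F) <= e / 2.
  rewrite -(ler_pXn2r (n := 2)) ?nnegrE ?ell2_norm_ge0 ?(ltW e2)//.
  rewrite sqr_ell2_norm; apply: le_trans ile; rewrite le_eqVlt; apply/orP; left.
  apply/eqP; congr fsum; apply/funext => y.
  by rewrite -[(u i - F) y]/(u i y - F y) FE.
apply: filterS iX => j uij.
rewrite -(subrK (u i) (u j)) -addrA (le_trans (ell2_normD _ _))//.
by rewrite [leRHS]splitr lerD.
Qed.

End limit.
End ell2_completeness.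

(** * Bounded operators with an adjoint *)

Section adjointable_operators.
Variables (R : realType) (T : choiceType) (S : set T).
Local Notation H := (ell2 R S).
Local Notation N := (@ell2_norm R T S).
Implicit Types (F G : H).

Definition op_bound (L : H -> H) (M : R) := forall F, N (L F) <= M * N F.

Definition is_adjoint (L L' : H -> H) :=
  forall F G, inner (L F) G = inner F (L' G).

(** By Riesz this is boundedness together with linearity; having the adjoint
    at hand makes the involution of the algebra available at once. *)
Definition adjointable (L : H -> H) :=
  (exists M, op_bound L M) /\ exists L', is_adjoint L L'.

Lemma is_adjointC L L' : is_adjoint L L' -> is_adjoint L' L.
Proof. by move=> LL' F G; rewrite innerJ -LL' -innerJ. Qed.

(** The inner product of K with L F is that of L' K with F, which is additive
    and conjugate-homogeneous in F, and a vector is determined by its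
    inner products. *)
Lemma is_adjoint_linear L L' : is_adjoint L L' -> linear L.
Proof.
move=> LL' z F G; apply: inner_ext => K.
by rewrite innerDr innerZr -!(is_adjointC LL') innerDr innerZr.
Qed.

Lemma is_adjoint_inj L L1 L2 : is_adjoint L L1 -> is_adjoint L L2 -> L1 = L2.
Proof.
by move=> h1 h2; apply/funext => F; apply: inner_ext => K; rewrite -h1 h2.
Qed.

(** |L'F|^2 = (LL'F, F), which is at most M |L'F| |F| by Cauchy-Schwarz;
    divide by |L'F|. *)
Lemma op_bound_adjoint L L' M : is_adjoint L L' -> op_bound L M -> op_bound L' M.
Proof.
move=> LL' LM F; have [E|E] := eqVneq (N (L' F)) 0.
  rewrite E; have := LM F; have := ell2_norm_ge0 (L F); exact: le_trans.
rewrite -(ler_pM2l (x := N (L' F))); last by rewrite lt_def E ell2_norm_ge0.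
have -> : N (L' F) * N (L' F) = normc (inner (L (L' F)) F).
  rewrite LL' inner_norm -expr2 /= expr0n /= addr0 sqrtr_sqr ger0_norm//.
  exact: sqr_ge0.
rewrite (le_trans (cauchy_schwarz _ _))// mulrCA mulrA.
by rewrite ler_wpM2r ?ell2_norm_ge0.
Qed.

Definition op_pred : {pred H -> H} := fun L => `[< adjointable L >].

Fact op_submod : submod_closed op_pred.
Proof.
split.
  apply/asboolP; split; first by exists 0 => F; rewrite ell2_norm0 mul0r.
  by exists 0 => F G; rewrite inner0l inner0r.
move=> z L K /asboolP[[M LM] [L' LL']] /asboolP[[M' KM'] [K' KK']].
apply/asboolP; split.
  exists (normc z * M + M') => F.
  rewrite -[(_ + _) F]/(z *: L F + K F) (le_trans (ell2_normD _ _))//.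
  by rewrite ell2_normZ mulrDl -mulrA lerD// ler_wpM2l// normc_nonneg.
exists (fun F => conjc z *: L' F + K' F) => F G.
rewrite -[(_ + _) F]/(z *: L F + K F).
by rewrite innerDl innerDr innerZl innerZr conjcK LL' KK'.
Qed.

HB.instance Definition _ := GRing.isSubmodClosed.Build _ _ op_pred op_submod.

Record bop := Bop { bop_val :> H -> H; _ : bop_val \in op_pred }.

HB.instance Definition _ := [isSub for bop_val].
HB.instance Definition _ := [Choice of bop by <:].
HB.instance Definition _ := [SubChoice_isSubLmodule of bop by <:].

Implicit Types A B C : bop.

Lemma bopP A B : (forall F, A F = B F) -> A = B.
Proof. by move=> AB; apply/val_inj/funext => F /=. Qed.

Lemma bop_bounded A : exists M, op_bound A M.
Proof. by have /asboolP[] := valP A. Qed.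

Lemma bop_adjointable A : exists L, is_adjoint A L.
Proof. by have /asboolP[] := valP A. Qed.

Lemma bopDE A B F : (A + B) F = A F + B F. Proof. by []. Qed.
Lemma bopZE z A F : (z *: A) F = z *: A F. Proof. by []. Qed.
Lemma bopBE A B F : (A - B) F = A F - B F. Proof. by []. Qed.

Lemma bop_linear A : linear A.
Proof. by have [L /is_adjoint_linear] := bop_adjointable A. Qed.

Lemma bopD A F G : A (F + G) = A F + A G.
Proof. by rewrite -[F]scale1r bop_linear !scale1r. Qed.

Lemma bop_at0 A : A 0 = 0.
Proof. by apply: (addrI (A 0)); rewrite -bopD !addr0. Qed.

Lemma bopZ A z F : A (z *: F) = z *: A F.
Proof. by rewrite -[z *: F]addr0 bop_linear bop_at0 addr0. Qed.

Lemma bop_bounded_op A : bounded_op A.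
Proof. by split; [exact: bop_linear | exact: bop_bounded]. Qed.

Definition opnorm A : R := inf [set M | 0 <= M /\ op_bound A M].

Lemma opnorm_has_inf A : has_inf [set M | 0 <= M /\ op_bound A M].
Proof.
split; last by exists 0 => M [].
have [M AM] := bop_bounded A; exists (Num.max M 0); split.
  by rewrite le_max lexx orbT.
move=> F; rewrite (le_trans (AM F))// ler_wpM2r ?ell2_norm_ge0//.
by rewrite le_max lexx.
Qed.

Lemma opnorm_ge0 A : 0 <= opnorm A.
Proof.
by apply: lb_le_inf; [case: (opnorm_has_inf A) | move=> M []].
Qed.

Lemma opnorm_le A M : 0 <= M -> op_bound A M -> opnorm A <= M.
Proof.
by move=> M0 AM; apply: ge_inf => //; case: (opnorm_has_inf A).
Qed.

(** The infimum of the bounds is itself a bound, as one sees after dividing by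
    [N F]. *)
Lemma opnormP A F : N (A F) <= opnorm A * N F.
Proof.
have [F0|F0] := eqVneq (N F) 0.
  by rewrite (ell2_norm_eq0 F0) bop_at0 ell2_norm0 mulr0.
have F1 : 0 < N F by rewrite lt_def F0 ell2_norm_ge0.
rewrite -ler_pdivrMr//; apply: lb_le_inf; first by case: (opnorm_has_inf A).
by move=> M [_ /(_ F)]; rewrite ler_pdivrMr.
Qed.

Lemma opnormD A B : opnorm (A + B) <= opnorm A + opnorm B.
Proof.
apply: opnorm_le => [|F]; first by rewrite addr_ge0 ?opnorm_ge0.
by rewrite bopDE (le_trans (ell2_normD _ _))// mulrDl lerD ?opnormP.
Qed.

(** Submultiplicativity in the scalar, applied to [z] and to its inverse. *)
Lemma opnormZ z A : opnorm (z *: A) = normc z * opnorm A.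
Proof.
have le w B : opnorm (w *: B) <= normc w * opnorm B.
  apply: opnorm_le => [|F]; first by rewrite mulr_ge0 ?normc_nonneg ?opnorm_ge0.
  by rewrite bopZE ell2_normZ -mulrA ler_wpM2l ?normc_nonneg ?opnormP.
apply/eqP; rewrite eq_le le /=.
have [->|z0] := eqVneq z 0; first by rewrite normc0 mul0r opnorm_ge0.
have nz : 0 < normc z.
  by rewrite lt_def normc_nonneg andbT; apply: contra z0 => /eqP/eq0_normc ->.
have := le z^-1 (z *: A); rewrite scalerA mulVf// scale1r normcV.
by rewrite ler_pdivlMl.
Qed.

Lemma opnorm_eq0 A : opnorm A = 0 -> A = 0.
Proof.
move=> A0; apply: bopP => F; apply: ell2_norm_eq0; apply/eqP.
by rewrite eq_le ell2_norm_ge0 andbT (le_trans (opnormP A F))// A0 mul0r.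
Qed.

Fact bop_normD A B :
  ((opnorm (A + B))%:C <= (opnorm A)%:C + (opnorm B)%:C)%C.
Proof. by rewrite -rmorphD lecR opnormD. Qed.

Fact bop_normZ (z : R[i]) A : (opnorm (z *: A))%:C%C = `|z| * (opnorm A)%:C%C.
Proof. by rewrite opnormZ rmorphM. Qed.

Fact bop_norm_eq0 A : (opnorm A)%:C%C = 0 -> A = 0.
Proof. by move=> [] /opnorm_eq0. Qed.

HB.instance Definition _ :=
  @Lmodule_isNormed.Build R[i] bop (fun A => (opnorm A)%:C%C)
    bop_normD bop_normZ bop_norm_eq0.

Lemma bop_normE A : `|A| = (opnorm A)%:C%C.
Proof. by []. Qed.
End adjointable_operators.

(** * The C*-algebra of operators on l^2 *)

Section operator_algebra.
Local Open Scope cstar_scope.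
Variables (R : realType) (T : choiceType) (S : set T).
Local Notation H := (ell2 R S).
Local Notation B := (bop R S).
Local Notation N := (@ell2_norm R T S).
Implicit Types (F G : H) (A C : B).

Fact adjoint_subproof A : { L : H -> H | is_adjoint A L }.
Proof. exact: cid (bop_adjointable A). Qed.

Fact adjoint_mem A : sval (adjoint_subproof A) \in @op_pred R T S.
Proof.
have h := svalP (adjoint_subproof A).
apply/asboolP; split; last by exists A; exact: is_adjointC.
by have [M /(op_bound_adjoint h)] := bop_bounded A; exists M.
Qed.

Definition bop_star A : B := Bop (adjoint_mem A).

Lemma bop_starP A : is_adjoint A (bop_star A).
Proof. exact: svalP (adjoint_subproof A). Qed.

Lemma bop_star_uniq A C : is_adjoint A C -> bop_star A = C.
Proof. by move=> /(is_adjoint_inj (bop_starP A)) AC; apply: val_inj. Qed.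

Fact bop_mul_mem A C : (A \o C : H -> H) \in @op_pred R T S.
Proof.
apply/asboolP; split.
  exists (opnorm A * opnorm C) => F /=.
  by rewrite (le_trans (opnormP _ _))// -mulrA ler_wpM2l ?opnorm_ge0 ?opnormP.
by exists (bop_star C \o bop_star A) => F G /=; rewrite !bop_starP.
Qed.

Definition bop_mul A C : B := Bop (bop_mul_mem A C).

Lemma bop_mulE A C F : bop_mul A C F = A (C F). Proof. by []. Qed.

Lemma bop_starK A : bop_star (bop_star A) = A.
Proof. exact/bop_star_uniq/is_adjointC/bop_starP. Qed.

Lemma bop_starD A C : bop_star (A + C) = bop_star A + bop_star C.
Proof.
by apply: bop_star_uniq => F G; rewrite !bopDE innerDl innerDr !bop_starP.
Qed.

Lemma bop_starZ z A : bop_star (z *: A) = conjc z *: bop_star A.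
Proof.
apply: bop_star_uniq => F G.
by rewrite !bopZE innerZl innerZr conjcK bop_starP.
Qed.

Lemma bop_starM A C : bop_star (bop_mul A C) = bop_mul (bop_star C) (bop_star A).
Proof.
by apply: bop_star_uniq => F G; rewrite !bop_mulE !bop_starP.
Qed.

Lemma opnormM A C : opnorm (bop_mul A C) <= opnorm A * opnorm C.
Proof.
apply: opnorm_le => [|F]; first by rewrite mulr_ge0 ?opnorm_ge0.
rewrite bop_mulE (le_trans (opnormP _ _))// -mulrA.
by rewrite ler_wpM2l ?opnorm_ge0 ?opnormP.
Qed.

Lemma opnorm_star A : opnorm (bop_star A) = opnorm A.
Proof.
have le C : opnorm (bop_star C) <= opnorm C.
  apply: opnorm_le; first exact: opnorm_ge0.
  exact: op_bound_adjoint (bop_starP C) (opnormP C).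
by apply/eqP; rewrite eq_le le -{1}(bop_starK A) le.
Qed.

(** The C*-identity: |AF|^2 = (F, A*AF) is at most |A*A| |F|^2 by
    Cauchy-Schwarz, so that the square root of |A*A| is a bound for [A]. *)
Lemma opnorm_cstar A : opnorm (bop_mul (bop_star A) A) = opnorm A ^+ 2.
Proof.
have := opnormM (bop_star A) A; rewrite opnorm_star -expr2 => le.
apply/eqP; rewrite eq_le le /=.
set c := opnorm (bop_mul _ _); have c0 : 0 <= c by exact: opnorm_ge0.
rewrite -[leRHS](sqr_sqrtr c0) ler_pXn2r ?nnegrE ?sqrtr_ge0 ?opnorm_ge0//.
apply: opnorm_le => [|F]; first exact: sqrtr_ge0.
rewrite -(ler_pXn2r (n := 2)) ?nnegrE ?mulr_ge0 ?sqrtr_ge0 ?ell2_norm_ge0//.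
rewrite exprMn (sqr_sqrtr c0).
have -> : N (A F) ^+ 2 = normc (inner F (bop_mul (bop_star A) A F)).
  rewrite bop_mulE -bop_starP inner_norm /= expr0n /= addr0 sqrtr_sqr.
  by rewrite ger0_norm// sqr_ge0.
rewrite (le_trans (cauchy_schwarz _ _))// expr2 mulrCA.
by rewrite ler_wpM2l ?ell2_norm_ge0 ?opnormP.
Qed.

Section complete.
Variables (X : set_system B) (PX : ProperFilter X).
Hypothesis X_cauchy : forall e : R, 0 < e ->
  exists A, \forall C \near X, opnorm (C - A) <= e.

Lemma pointwise_limit (f : B -> B) :
  (forall A C F, N (f A F - f C F) <= opnorm (A - C) * N F) ->
  exists L : H -> H, forall F (e : R), 0 < e ->
    \forall C \near X, N (f C F - L F) <= e.
Proof.
move=> f_lip.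
have lim F : exists LF, forall e : R, 0 < e ->
    \forall C \near X, N (f C F - LF) <= e; last first.
  by have [L LX] := choice lim; exists L.
apply: ell2_complete => e e0.
(* Adding 1 keeps the denominator positive when [F] vanishes. *)
have d0 : 0 < N F + 1 by rewrite ltr_wpDl ?ell2_norm_ge0.
have [A AX] := X_cauchy (divr_gt0 e0 d0); exists A.
apply: filterS AX => C CA; rewrite (le_trans (f_lip _ _ _))//.
rewrite (le_trans (ler_wpM2r (ell2_norm_ge0 F) CA))//.
by rewrite -mulrA ler_piMr ?(ltW e0)// ler_pdivrMl// mulr1 lerDl.
Qed.

(** The pointwise limits of the operators and of their adjoints both exist,
    because the involution is isometric; the two limits are adjoint to
    each other by continuity of the inner product, and the Cauchy
    estimates pass to the limit pointwise, hence uniformly on balls. *)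
Lemma bop_limit : exists A, forall e : R, 0 < e ->
  \forall C \near X, opnorm (C - A) <= e.
Proof.
have lip1 A C F : N (A F - C F) <= opnorm (A - C) * N F.
  by have := opnormP (A - C) F; rewrite bopBE.
have lip2 A C F : N (bop_star A F - bop_star C F) <= opnorm (A - C) * N F.
  have -> : opnorm (A - C) = opnorm (bop_star A - bop_star C).
    rewrite -opnorm_star bop_starD -scaleN1r bop_starZ conjcN conjc1.
    by rewrite scaleN1r.
  by have := opnormP (bop_star A - bop_star C) F; rewrite bopBE.
have [L LX] := pointwise_limit (f := id) lip1.
have [L' L'X] := pointwise_limit lip2.
have near_bound A (e : R) : (\forall C \near X, opnorm (C - A) <= e) ->
    forall F, N (A F - L F) <= e * N F.
  move=> AX F; apply/ler_addgt0Pr => d d0.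
  have [C [CA CL]] : exists C, opnorm (C - A) <= e /\ N (C F - L F) <= d.
    by apply: (@filter_ex _ X); apply: filterI AX (LX F _ d0).
  rewrite -(subrK (C F) (A F)) -addrA (le_trans (ell2_normD _ _))// lerD//.
  rewrite ell2_distC (le_trans (opnormP (C - A) F))//.
  by rewrite ler_wpM2r ?ell2_norm_ge0.
have L_adj : is_adjoint L L'.
  move=> F G; apply/eqP; rewrite -subr_eq0; apply/eqP/eq0_normc.
  apply/eqP; rewrite eq_le normc_nonneg andbT; apply/ler_addgt0Pr => d d0.
  rewrite add0r.
  (* Adding 1 keeps the denominator positive when both norms vanish. *)
  pose c := N F + N G + 1.
  have c0 : 0 < c by rewrite ltr_wpDl// addr_ge0 ?ell2_norm_ge0.
  have [C [CL CL']] : exists C, N (C F - L F) <= d / c /\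
      N (bop_star C G - L' G) <= d / c.
    apply: (@filter_ex _ X).
    exact: filterI (LX F _ (divr_gt0 d0 c0)) (L'X G _ (divr_gt0 d0 c0)).
  have -> : inner (L F) G - inner F (L' G) =
      inner (L F - C F) G + inner F (bop_star C G - L' G).
    by rewrite innerBl innerBr bop_starP; ring.
  rewrite (le_trans (le_normcD _ _))//.
  rewrite (le_trans (lerD (cauchy_schwarz _ _) (cauchy_schwarz _ _)))//.
  rewrite ell2_distC.
  have := ler_wpM2r (ell2_norm_ge0 G) CL.
  have := ler_wpM2l (ell2_norm_ge0 F) CL'.
  have : d / c * c = d by rewrite divfK// gt_eqF.
  have : 0 <= d / c by rewrite divr_ge0 ?ltW.
  rewrite {3}/c; lra.
have L_mem : L \in @op_pred R T S.
  apply/asboolP; split; last by exists L'.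
  have [A AX] := X_cauchy ltr01; exists (1 + opnorm A) => F.
  rewrite mulrDl -(subrK (A F) (L F)) (le_trans (ell2_normD _ _))//.
  apply: lerD; last exact: opnormP.
  by rewrite ell2_distC; exact: near_bound AX F.
exists (Bop L_mem) => e e0.
have e2 : 0 < e / 2 by rewrite divr_gt0.
have [A AX] := X_cauchy e2.
have AL : opnorm (A - Bop L_mem) <= e / 2.
  by apply: opnorm_le (ltW e2) _ => F; exact: near_bound AX F.
apply: filterS AX => C CA.
rewrite -(subrK A C) -addrA (le_trans (opnormD _ _))//.
by rewrite [leRHS]splitr lerD.
Qed.

End complete.

(** Radii of balls are complex numbers here, and a positive complex number is
    real; this translates between them and the real estimates of
    [bop_limit]. *)
Fact bop_complete (X : set_system B) : ProperFilter X -> cauchy X -> cvg X.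
Proof.
move=> PX /cauchyP Xc.
have [e e0|A AX] := @bop_limit X PX.
  have ec0 : 0 < (e%:C)%C :> R[i] by rewrite ltcR.
  have [A AX] := Xc _ ec0; exists A; apply: filterS AX => C.
  by rewrite -ball_normE /= distrC bop_normE ltcR => /ltW.
apply/cvg_ex; exists A; apply/fcvg_ballP => e e0.
have eE : e = ((complex.Re e)%:C)%C by rewrite RRe_real// gtr0_real.
have e1 : 0 < complex.Re e / 2.
  by rewrite divr_gt0// -ltcR -eE.
have := AX _ e1; apply: filterS => C CA.
rewrite -ball_normE /= distrC bop_normE eE ltcR.
by rewrite (le_lt_trans CA)// ltr_pdivrMr// ltr_pMr ?ltr1n// -ltcR -eE.
Qed.

HB.instance Definition _ := Uniform_isComplete.Build B bop_complete.

Fact bop_mulA A C D : bop_mul A (bop_mul C D) = bop_mul (bop_mul A C) D.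
Proof. exact: bopP. Qed.

Fact bop_mulDl A C D : bop_mul (A + C) D = bop_mul A D + bop_mul C D.
Proof. exact: bopP. Qed.

Fact bop_mulDr A C D : bop_mul A (C + D) = bop_mul A C + bop_mul A D.
Proof. by apply: bopP => F; rewrite !(bop_mulE, bopDE) bopD. Qed.

Fact bop_mulZl z A C : bop_mul (z *: A) C = z *: bop_mul A C.
Proof. exact: bopP. Qed.

Fact bop_mulZr z A C : bop_mul A (z *: C) = z *: bop_mul A C.
Proof. by apply: bopP => F; rewrite !(bop_mulE, bopZE) bopZ. Qed.

Fact bop_norm_mul A C : `|bop_mul A C| <= `|A| * `|C|.
Proof. by rewrite !bop_normE -rmorphM lecR opnormM. Qed.

Fact bop_norm_cstar A : `|bop_mul (bop_star A) A| = `|A| ^+ 2.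
Proof. by rewrite !bop_normE opnorm_cstar rmorphXn. Qed.

Definition bop_cstar : cstarAlg R :=
  @CstarAlg R B bop_mul bop_star bop_mulA bop_mulDl bop_mulDr bop_mulZl
    bop_mulZr bop_starK bop_starD bop_starZ bop_starM bop_norm_mul
    bop_norm_cstar.

End operator_algebra.

(** * Operators of restriction and of transport along a bijection *)

Section partial_bijections.
Variables (R : realType) (T : choiceType) (S : set T).
Local Notation H := (ell2 R S).
Local Notation B := (bop R S).
Local Notation N := (@ell2_norm R T S).
Implicit Types (F G : H).

Lemma sum_mkcond (f : T -> R[i]) (E : set T) : E `<=` S ->
  csum S (fun y => \1_E y * f y) = csum E f.
Proof.
move=> ES.
have rE (h h' : T -> R) : (forall y, E y -> h y = h' y) ->
    (forall y, ~ E y -> h y = 0) -> rsum S h = rsum E h'.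
  move=> hh h0.
  have fE (k k' : T -> R) : (forall y, E y -> k y = k' y) ->
      (forall y, ~ E y -> k y = 0) -> fsum S k = fsum E k'.
    move=> kk k0; rewrite /fsum -(setIidr ES) esum_mkcondr; congr fine.
    apply: eq_esum => y _; case: ifPn => [/set_mem/kk ->//|/negP nE].
    by rewrite k0// => Ey; apply: nE; rewrite inE.
  rewrite !rsumE; congr (_ - _); apply: fE => y Ey.
  - by rewrite hh.
  - by rewrite h0// maxxx.
  - by rewrite hh.
  - by rewrite h0// oppr0 maxxx.
congr Complex; apply: rE => y Ey; rewrite indicE.
- by rewrite mem_set// mul1r.
- by rewrite memNset// mul0r.
- by rewrite mem_set// mul1r.
- by rewrite memNset// mul0r.
Qed.

Lemma csum_reindex (E E' : set T) (k : T -> T) (f : T -> R[i]) :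
  set_bij E E' k -> csum E' f = csum E (fun y => f (k y)).
Proof.
move=> kb.
have rE (h : T -> R) : rsum E' h = rsum E (fun y => h (k y)).
  by rewrite !rsumE /fsum !(reindex_esum _ _ _ _ kb).
by rewrite /csum !rE.
Qed.

Section composition.
Variables (E E' : set T) (k h : T -> T).
Hypotheses (ES : E `<=` S) (E'S : E' `<=` S).
Hypotheses (kE : forall y, E y -> E' (k y) /\ h (k y) = y).
Hypotheses (hE : forall y, E' y -> E (h y) /\ k (h y) = y).

Lemma partial_bij : set_bij E E' k.
Proof.
split=> [y /kE[]//|y z /set_mem Ey /set_mem Ez kyz|y E'y].
  by rewrite -(kE Ey).2 kyz (kE Ez).2.
by exists (h y); have [] := hE E'y.
Qed.

Fact comp_subproof F :
  (fun y => \1_E y * F (k y)) \in @ell2_pred R T S /\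
  fsum S (fun y => normc (\1_E y * F (k y)) ^+ 2) <= N F ^+ 2.
Proof.
pose f y := normc (F y) ^+ 2.
have f0 y : 0 <= f y by exact: sqr_ge0.
have eE : (\esum_(y in S) (normc (\1_E y * F (k y)) ^+ 2)%:E =
    \esum_(y in E') (f y)%:E)%E.
  rewrite (reindex_esum _ _ _ _ partial_bij).
  rewrite -[X in _ = esum X _](setIidr ES) esum_mkcondr.
  apply: eq_esum => y _; rewrite indicE; case: ifPn => yE.
    by rewrite mul1r.
  by rewrite mul0r normc0 expr0n.
have le : (\esum_(y in E') (f y)%:E <= \esum_(y in S) (f y)%:E)%E.
  rewrite (esumID E' S); last by move=> y _; rewrite lee_fin.
  by rewrite (setIidr E'S) leeDl// esum_ge0// => y _; rewrite lee_fin.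
have fS := esum_fin (ell2_asum F) f0.
split; last first.
  rewrite sqr_ell2_norm /fsum eE fine_le//.
  rewrite ge0_fin_numE ?esum_ge0//; last by move=> y _; rewrite lee_fin.
  by rewrite (le_lt_trans le)// -(fineK fS) ltry.
apply/ell2_memP; split.
  by move=> y nS; rewrite indicE memNset ?mul0r// => /ES.
rewrite /asum; under eq_esum do rewrite ger0_norm ?sqr_ge0//.
by rewrite eE (le_lt_trans le)// -(fineK fS) ltry.
Qed.

(** Composition with a bijection [k] of [E] onto [E'], with inverse [h],
    extended by 0 outside [E]. For the branching system, [E] is the set
    attached to an edge, [E'] the set attached to its range, and [k] is
    the map [g]. *)
Definition comp_fun F : H := Ell2 (comp_subproof F).1.

Lemma comp_funE F y : comp_fun F y = \1_E y * F (k y).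
Proof. by []. Qed.

Lemma comp_fun_bound : op_bound comp_fun 1.
Proof.
move=> F; rewrite mul1r -(ler_pXn2r (n := 2)) ?nnegrE ?ell2_norm_ge0//.
by rewrite [leLHS]sqr_ell2_norm; have [] := comp_subproof F.
Qed.
End composition.

Section composition_adjoint.
Variables (E E' : set T) (k h : T -> T).
Hypotheses (ES : E `<=` S) (E'S : E' `<=` S).
Hypotheses (kE : forall y, E y -> E' (k y) /\ h (k y) = y).
Hypotheses (hE : forall y, E' y -> E (h y) /\ k (h y) = y).

(** Change of variables along the bijection: the adjoint transports along its
    inverse. *)
Fact comp_fun_adjoint :
  is_adjoint (comp_fun ES E'S kE hE) (comp_fun E'S ES hE kE).
Proof.
move=> F G.
transitivity (csum E' (fun y => F y * conjc (G (h y)))).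
  rewrite (csum_reindex _ (partial_bij kE hE)) -(sum_mkcond _ ES).
  apply: eq_csum => y _; rewrite comp_funE indicE mulrA.
  by case: (boolP (y \in E)) => [/set_mem/kE[_ ->]//|_]; rewrite !mul0r.
rewrite -(sum_mkcond _ E'S); apply: eq_csum => y _.
rewrite comp_funE conjcM indicE mulrCA; congr (_ * _).
by case: (y \in E'); rewrite ?conjc1 ?conjc0 ?mul1r ?mul0r.
Qed.

Fact comp_op_mem : comp_fun ES E'S kE hE \in @op_pred R T S.
Proof.
apply/asboolP; split; last by exists (comp_fun E'S ES hE kE); exact: comp_fun_adjoint.
by exists 1; exact: comp_fun_bound.
Qed.

Definition comp_op : B := Bop comp_op_mem.

Lemma comp_opE F y : comp_op F y = \1_E y * F (k y).
Proof. by []. Qed.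

End composition_adjoint.

Lemma comp_op_star (E E' : set T) (k h : T -> T) (ES : E `<=` S)
    (E'S : E' `<=` S) kE hE F y :
  bop_star (@comp_op E E' k h ES E'S kE hE) F y = \1_E' y * F (h y).
Proof.
suff -> : bop_star (comp_op ES E'S kE hE) = comp_op E'S ES hE kE by [].
apply: bop_star_uniq; exact: comp_fun_adjoint.
Qed.

(** Multiplication by the indicator of [D], as transport along the identity of
    [D `&` S]. *)
Definition restr_op (D : set T) : B :=
  @comp_op (D `&` S) (D `&` S) id id (@subIsetr _ _ _) (@subIsetr _ _ _)
    (fun y Dy => conj Dy erefl) (fun y Dy => conj Dy erefl).

Lemma restr_opE D F y : restr_op D F y = \1_D y * F y.
Proof.
rewrite comp_opE !indicE in_setI; case: (boolP (y \in S)); first by rewrite andbT.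
by move=> /negP nS; rewrite ell2_out ?mulr0// => Sy; apply: nS; rewrite inE.
Qed.

Lemma restr_op_star D : bop_star (restr_op D) = restr_op D.
Proof. by apply: bop_star_uniq; exact: comp_fun_adjoint. Qed.

Lemma restr_opM D D' : bop_mul (restr_op D) (restr_op D') = restr_op (D `&` D').
Proof.
apply: bopP => F; apply: ell2P => y _; rewrite bop_mulE !restr_opE mulrA.
by rewrite !indicE in_setI; case: (y \in D); case: (y \in D');
  rewrite ?mul1r ?mul0r.
Qed.

Lemma restr_op0 : restr_op set0 = 0.
Proof.
apply: bopP => F; apply: ell2P => y _.
by rewrite restr_opE indicE in_set0 mul0r.
Qed.

Lemma restr_opU D D' :
  restr_op (D `|` D') = restr_op D + restr_op D' - restr_op (D `&` D').
Proof.
apply: bopP => F; apply: ell2P => y _.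
rewrite bopBE bopDE ell2D ell2N ell2D !restr_opE !indicE in_setU in_setI.
by case: (y \in D); case: (y \in D') => /=; ring.
Qed.

(** Differences of restrictions to nested sets are again projections, hence of
    the form c* c. This is what the order relation in the definition of a
    family asks for. *)
Lemma restr_opB D D' : D' `<=` D ->
  restr_op D - restr_op D' = restr_op (D `\` D').
Proof.
move=> DD; apply/eqP; rewrite subr_eq; apply/eqP.
rewrite -{1}(setDUK DD) restr_opU setDIK restr_op0 subr0.
by rewrite addrC.
Qed.

Section partial_isometry.
Variables (E E' : set T) (k h : T -> T).
Hypotheses (ES : E `<=` S) (E'S : E' `<=` S).
Hypotheses (kE : forall y, E y -> E' (k y) /\ h (k y) = y).
Hypotheses (hE : forall y, E' y -> E (h y) /\ k (h y) = y).

Let V := comp_op ES E'S kE hE.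

Lemma comp_op_range : bop_mul V (bop_star V) = restr_op E.
Proof.
apply: bopP => F; apply: ell2P => y _.
rewrite bop_mulE comp_opE comp_op_star restr_opE !indicE.
case: (boolP (y \in E)) => [/set_mem/kE[E'k ->]|_]; last by rewrite !mul0r.
by rewrite mem_set// !mul1r.
Qed.

Lemma comp_op_source : bop_mul (bop_star V) V = restr_op E'.
Proof.
apply: bopP => F; apply: ell2P => y _.
rewrite bop_mulE comp_op_star comp_opE restr_opE !indicE.
case: (boolP (y \in E')) => [/set_mem/hE[Eh ->]|_]; last by rewrite !mul0r.
by rewrite mem_set// !mul1r.
Qed.

Lemma restr_comp_op : bop_mul (restr_op E) V = V.
Proof.
apply: bopP => F; apply: ell2P => y _; rewrite bop_mulE restr_opE comp_opE.
by rewrite !indicE; case: (y \in E); rewrite ?mul1r ?mul0r.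
Qed.

End partial_isometry.

Lemma bop_star_coord (A : B) F y : S y ->
  bop_star A F y = inner F (A (ell2_delta R S y)).
Proof. by move=> Sy; rewrite -(inner_delta _ Sy) (is_adjointC (bop_starP A)). Qed.

(** The values on the basis give the coordinates of the adjoint, hence the
    adjoint, hence the operator. This avoids density of the finitely
    supported functions. *)
Lemma bop_delta_ext (A C : B) :
  (forall y, S y -> A (ell2_delta R S y) = C (ell2_delta R S y)) -> A = C.
Proof.
move=> AC; rewrite -(bop_starK A) -(bop_starK C); congr bop_star.
by apply: bopP => F; apply: ell2P => y Sy; rewrite !bop_star_coord// AC.
Qed.

End partial_bijections.

(** * Representations as homomorphisms *)

Section representations.
Local Open Scope cstar_scope.
Variables (R : realType) (T : choiceType) (S : set T) (A : cstarAlg R).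
Local Notation B := (bop_cstar R S).
Implicit Types rho : A -> ell2 R S -> ell2 R S.

Lemma star_hom_rep (phi : A -> B) : star_hom phi ->
  star_rep (fun a => bop_val (phi a)).
Proof.
case=> phiD phiZ phiM phiS; split=> [a|a b F|z a F|a b F|a F G].
- exact: bop_bounded_op.
- by rewrite phiD.
- by rewrite phiZ.
- by rewrite phiM.
- by rewrite phiS; exact: bop_starP.
Qed.

Lemma star_rep_mem rho : star_rep rho -> forall a, rho a \in @op_pred R T S.
Proof.
by case=> bd _ _ _ adj a; apply/asboolP; split; [case: (bd a)|
  exists (rho a^*); exact: adj].
Qed.

(** The clause on adjoints in the definition of a representation is exactly
    what makes its operators elements of the algebra and the map
    compatible with involutions. *)
Lemma star_rep_hom rho (hr : star_rep rho) :
  star_hom (fun a => Bop (star_rep_mem hr a) : B).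
Proof.
have [_ rD rZ rM adj] := hr; split=> [a b|z a|a b|a].
- by apply: bopP => F; exact: rD.
- by apply: bopP => F; exact: rZ.
- by apply: bopP => F; exact: rM.
- by apply/esym/bop_star_uniq; exact: adj.
Qed.

End representations.

(** * Backward orbits of Markov maps *)

Section markov_dynamics.
Variables (R : realType) (a : R) (b : \bar R) (g : R -> R) (lo hi : nat -> R).
Hypothesis hg : markov_class a b g lo hi.
Local Notation piece := (piece lo hi).
Local Notation dom := (mk_domain lo hi).
Local Notation bd := (bdpoints lo hi).
Local Notation rng := (mk_rng g lo hi).

Lemma pieceE n (y : R) : piece n y = (lo n <= y <= hi n) :> Prop.
Proof. by rewrite /Defs.piece /= in_itv. Qed.

Lemma piece_interiorE n (y : R) : (piece n)° y = (lo n < y < hi n) :> Prop.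
Proof. by rewrite interior_itv_bnd /= in_itv. Qed.

Lemma pieces_ordered i j : (i < j)%N -> hi i <= lo j.
Proof.
elim: j => // j IH; rewrite ltnS leq_eqVlt => /orP[/eqP ->|/IH h].
  exact: mk_ord hg j.
by rewrite (le_trans h)// (le_trans (mk_le hg j))// (mk_ord hg).
Qed.

(** Pieces are ordered, so a point of the interior of one piece lies strictly
    between the other ones, including those reduced to a point. *)
Lemma interior_piece_uniq i j (y : R) : (piece i)° y -> piece j y -> i = j.
Proof.
rewrite piece_interiorE pieceE => /andP[il ih] /andP[jl jh].
by have [/pieces_ordered h|/pieces_ordered h|//] := ltngtP i j; exfalso; lra.
Qed.

Lemma gap_notin_domain J (z : R) : gap lo hi J z -> ~ dom z.
Proof.
rewrite /gap /= in_itv /= => /andP[zh zl] [m _]; rewrite pieceE.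
move=> /andP[ml mh]; have [/pieces_ordered|Jm|mJ] := ltngtP m J.
- have := mk_le hg J; lra.
- have : lo J.+1 <= lo m.
    move: Jm; rewrite leq_eqVlt => /orP[/eqP ->//|/pieces_ordered].
    by apply: le_trans; exact: mk_le hg _.
  by move: Jm => _; lra.
- by subst m; lra.
Qed.

Lemma closure_piece n : closure (piece n) = piece n.
Proof. by rewrite -(closure_id _).1//; exact: interval_closed. Qed.

Lemma bdpoints_domain : bd `<=` dom.
Proof.
by move=> y [n _ [cy _]]; exists n => //; rewrite -closure_piece.
Qed.

Lemma piece_bdpoint i y : piece i y -> ~ (piece i)° y -> bd y.
Proof. by move=> iy niy; exists i => //; split=> //; exact: subset_closure. Qed.

(** In particular a degenerate piece cannot sit in the interior of another
    one. *)
Lemma interior_not_bdpoint j y : (piece j)° y -> ~ bd y.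
Proof.
move=> jy [n _ [cy ny]]; have ny' : piece n y.
  by rewrite closure_piece in cy.
by apply: ny; rewrite -(interior_piece_uniq jy ny').
Qed.

Lemma bdpoints_iter n y : bd y -> bd (iter n g y).
Proof. by elim: n => //= n IH /IH h; apply: (mk_bd hg); exists (iter n g y). Qed.

Variables (x : R) (J : nat).
Hypothesis hJ : gap lo hi J (escape_point g lo hi x).
Local Notation S := (orbit_set g lo hi x).
Local Notation z := (escape_point g lo hi x).

Lemma orbit_domain y : S y -> dom y. Proof. by case. Qed.

(** The forward orbit of an endpoint consists of endpoints, which belong to
    the domain, whereas the orbit of a point of [S] reaches the escape
    point, which does not. *)
Lemma orbit_not_bdpoint y : S y -> ~ bd y.
Proof.
move=> [_ [n [_ _ E]]] /(bdpoints_iter n); rewrite E => /bdpoints_domain.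
exact: gap_notin_domain hJ.
Qed.

Lemma orbit_interior j y : S y -> piece j y -> (piece j)° y.
Proof.
by move=> Sy jy; apply: contrapT => /(piece_bdpoint jy); exact: orbit_not_bdpoint.
Qed.

Lemma orbit_piece_uniq i j y : S y -> piece i y -> piece j y -> i = j.
Proof. by move=> Sy iy; apply: interior_piece_uniq; exact: orbit_interior. Qed.

Lemma orbit_preim y : dom y -> S (g y) -> S y.
Proof.
move=> dy [_ [n [n0 it E]]]; split=> //; exists n.+1; split=> //; last first.
  by rewrite iterSr.
by move=> [|k] kn //; rewrite iterSr; apply: it.
Qed.

(** A point of the backward orbit escapes in one step, or else its image still
    has to escape. *)
Lemma orbit_image y : S y -> g y = z \/ S (g y).
Proof.
move=> [dy [[|[|n]] [//= _ it E]]]; first by left.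
right; split; first exact: (it 1%N).
exists n.+1; split=> //; last by rewrite -iterSr.
by move=> k kn; rewrite -iterSr; apply: it.
Qed.

Local Notation D := (bs_D g lo hi x).
Local Notation V := (bs_R g lo hi x).
Local Notation inv := (ginv g lo hi).

Lemma bs_D_sub B : D B `<=` S.
Proof. by move=> y [j _ []]. Qed.

Lemma bs_R_sub i : V i `<=` D [set i].
Proof.
move=> y [j _ [iy [_ Sgy]]]; exists i => //; split=> //.
by apply: orbit_preim Sgy; exists i.
Qed.

Lemma bs_R_image i y : V i y -> D (rng i) (g y).
Proof. by move=> [j rj [_ Sgy]]; exists j. Qed.

(** Points of [S] are interior, and [g] is injective on interiors of pieces
    only. *)
Lemma bs_R_inj i y y' : V i y -> V i y' -> g y = g y' -> y = y'.
Proof.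
have int u : V i u -> (piece i)° u.
  by move=> /bs_R_sub [_ -> [iu Su]]; exact: orbit_interior.
by move=> /int iy /int iy' E; apply: (mk_inj hg (i := i)); rewrite ?inE.
Qed.

(** A point of [S] in a piece indexed by the range of the i-th edge is
    interior to that piece, hence has a preimage in the interior of the
    i-th piece by definition of the range. The value of [ginv] may be
    another preimage in the closed piece, but any such preimage belongs to
    [S] again. *)
Lemma ginvP i w : D (rng i) w -> V i (inv i w) /\ g (inv i w) = w.
Proof.
move=> [j rj [jw Sw]].
have [u iu gu] := rj _ (orbit_interior Sw jw).
have [/= iv gv] : [set v | piece i v /\ g v = w] (inv i w).
  by apply: (@xgetPex _ w); exists u; split=> //; exact: interior_subset iu.
by split=> //; exists j => //; split=> //; rewrite /preimage /= gv.
Qed.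

Lemma ginvK i y : V i y -> inv i (g y) = y.
Proof.
move=> Vy; have [Vi E] := ginvP (bs_R_image Vy).
exact: bs_R_inj Vi Vy E.
Qed.

Lemma bs_R_disjoint i j : i <> j -> V i `&` V j = set0.
Proof.
move=> ij; apply/seteqP; split=> // y [/bs_R_sub[_ -> [iy Sy]]].
by move=> /bs_R_sub[_ -> [jy _]]; apply: ij; exact: orbit_piece_uniq iy jy.
Qed.

Lemma bs_DI B C : D B `&` D C = D (B `&` C).
Proof.
apply/seteqP; split=> y.
  move=> [[j Bj [jy Sy]] [k Ck [ky _]]]; exists j => //; split=> //.
  by rewrite (orbit_piece_uniq Sy jy ky).
by move=> [j [Bj Cj] [jy Sy]]; split; exists j.
Qed.

Lemma bs_DU B C : D B `|` D C = D (B `|` C).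
Proof. by rewrite /bs_D bigcup_setU. Qed.

Lemma bs_D0 : D set0 = set0.
Proof. by rewrite /bs_D bigcup_set0. Qed.

(** If a point of [S] in the i-th piece does not escape at once, its image
    lies in [S], hence in the interior of a unique piece, say the j-th.
    The Markov property puts that whole piece inside [g @` piece i]. Its
    interior is even covered by the interior of the i-th piece, since
    endpoints are mapped to endpoints; so j is in the range of the i-th
    edge. *)
Lemma bs_D_cover i :
  (piece i)° `&` (dom `&` g @^-1` (gap lo hi J)) = set0 -> D [set i] = V i.
Proof.
move=> noesc; apply/seteqP; split; last exact: bs_R_sub.
move=> y [_ -> [iy Sy]]; have iiy := orbit_interior Sy iy.
have [gz|Sgy] := orbit_image Sy.
  have : ((piece i)° `&` (dom `&` g @^-1` (gap lo hi J))) y.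
    by split=> //; split; [exists i|rewrite /preimage /= gz].
  by rewrite noesc.
have [j _ jgy] := orbit_domain Sgy; exists j; last by [].
have [M [_ ME]] := mk_union hg i.
(* The Markov property, a priori about some piece through [g y], applies to the
   j-th one because that piece is unique. *)
have [n Mn ngy] : (\bigcup_(n in M) piece n) (g y).
  by rewrite -ME; split; [exists y|exists j].
have nj := orbit_piece_uniq Sgy ngy jgy; subst n.
move=> w jw.
have [[u iu guw] _] : (g @` piece i `&` dom) w.
  by rewrite ME; exists j => //; exact: interior_subset.
exists u => //; apply: contrapT => /(piece_bdpoint iu) bu.
apply: (interior_not_bdpoint jw); rewrite -guw.
by apply: (mk_bd hg); exists u.
Qed.

End markov_dynamics.

(** * The family of operators on a backward orbit *)

Section induced_family.
Variables (R : realType) (a : R) (b : \bar R) (g : R -> R) (lo hi : nat -> R).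
Hypothesis hg : markov_class a b g lo hi.
Variables (x : R) (J : nat).
Hypothesis hJ : gap lo hi J (escape_point g lo hi x).
Local Notation S := (orbit_set g lo hi x).
Local Notation G := (markov_ultragraph g lo hi).
Local Notation B := (bop R S).
Local Notation D := (bs_D g lo hi x).
Local Notation V := (bs_R g lo hi x).
Local Notation rng := (mk_rng g lo hi).
Local Notation delta := (ell2_delta R S).

Definition vertex_op (C : set nat) : B := restr_op R S (D C).

Lemma bs_R_orbit i : V i `<=` S.
Proof. by move=> y /bs_R_sub/bs_D_sub. Qed.

Definition edge_op (i : nat) : B :=
  comp_op R (@bs_R_orbit i) (@bs_D_sub R g lo hi x (rng i))
    (fun y Vy => conj (bs_R_image Vy) (ginvK hg hJ Vy))
    (fun w Dw => ginvP hg hJ Dw).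

Lemma vertex_opE C F y : vertex_op C F y = \1_(D C) y * F y.
Proof. exact: restr_opE. Qed.

Lemma edge_opE i F y : edge_op i F y = \1_(V i) y * F (g y).
Proof. by []. Qed.

Lemma edge_op_range i :
  bop_mul (edge_op i) (bop_star (edge_op i)) = restr_op R S (V i).
Proof. exact: comp_op_range. Qed.

Lemma edge_op_source i :
  bop_mul (bop_star (edge_op i)) (edge_op i) = vertex_op (rng i).
Proof. exact: comp_op_source. Qed.

(** All relations but the last express that the sets attached to vertices and
    edges behave like the projections they define; the last one is
    [bs_D_cover]. *)
Lemma vertex_edge_family (X : set nat) :
  (forall i, X i -> (piece lo hi i)° `&`
     (mk_domain lo hi `&` g @^-1` (gap lo hi J)) = set0) ->
  @ug_family R G X (bop_cstar R S) edge_op vertex_op.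
Proof.
move=> hX; split.
- split=> [e|e f ef].
    by rewrite /cs_partial_isometry /= edge_op_range; exact: restr_comp_op.
  by rewrite /= !edge_op_range restr_opM (bs_R_disjoint hg hJ ef) restr_op0.
- move=> C _; split; first exact: restr_op_star.
  by rewrite /= restr_opM setIid.
- split.
  + by rewrite /vertex_op bs_D0 restr_op0.
  + by move=> C C' _ _; rewrite /= restr_opM (bs_DI hg hJ).
  + by move=> C C' _ _; rewrite /vertex_op -bs_DU restr_opU (bs_DI hg hJ).
- split=> e; first exact: edge_op_source.
  rewrite /= edge_op_range; exists (restr_op R S (D [set e] `\` V e)) => /=.
  rewrite restr_op_star restr_opM setIid; apply: restr_opB; exact: bs_R_sub.
- move=> i Xi; rewrite (_ : [set e | _] = [set i]); last by [].
  rewrite fsbig_set1 /= edge_op_range /vertex_op.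
  by rewrite (bs_D_cover hg hJ (hX i Xi)).
Qed.

Lemma vertex_op_is_W C : is_W C (vertex_op C).
Proof.
split=> [|y Sy]; first exact: bop_bounded_op.
apply: ell2P => z Sz; rewrite vertex_opE ell2Z ell2_deltaE// !indicE.
have [->|_] := eqVneq z y; last by rewrite !mulr0.
congr ((_ : bool)%:R * _); apply/idP/idP; rewrite !inE.
  by move=> [j Cj [jy _]]; exists j.
by move=> [j Cj jy]; exists j.
Qed.

Lemma edge_op_is_T i : is_T i (edge_op i).
Proof.
split=> [|y Sy]; first exact: bop_bounded_op.
apply: ell2P => z Sz; rewrite edge_opE ell2Z ell2_deltaE//.
have [Dy|nDy] := pselect (D (rng i) y).
  have [Vy gy] := ginvP hg hJ Dy.
  rewrite (ell2_deltaE R (bs_R_orbit Vy)) [X in _ = X * _]indicE mem_set; last first.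
    by case: Dy => j rj [jy _]; exists j.
  rewrite mul1r indicE; have [->|zy] := eqVneq z (ginv g lo hi i y).
    by rewrite mem_set// gy eqxx mulr1.
  case: (boolP (z \in V i)) => [/set_mem Vz|_]; last by rewrite mul0r.
  rewrite mul1r; case: eqP => // gzy; case/eqP: zy.
  by rewrite -gzy (ginvK hg hJ Vz).
rewrite [X in _ = X * _]indicE memNset; last first.
  by move=> [j rj jy]; apply: nDy; exists j.
rewrite mul0r indicE; case: (boolP (z \in V i)) => [/set_mem Vz|_]; last first.
  by rewrite mul0r.
rewrite mul1r; case: eqP => // gzy; case: nDy; rewrite -gzy.
exact: bs_R_image.
Qed.

Lemma is_W_uniq C (A : B) : is_W C A -> A = vertex_op C.
Proof.
move=> [_ h]; apply: bop_delta_ext => y Sy; rewrite h//.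
by have [_ ->] := vertex_op_is_W C.
Qed.

Lemma is_T_uniq i (A : B) : is_T i A -> A = edge_op i.
Proof.
move=> [_ h]; apply: bop_delta_ext => y Sy; rewrite h//.
by have [_ ->] := edge_op_is_T i.
Qed.

End induced_family.

Theorem theorem5p11 (R : realType) (a : R) (b : \bar R) (hb : b <> -oo%E)
    (g : R -> R) (lo hi : nat -> R) (hg : markov_class a b g lo hi)
    (x : R) (hx : escaping g lo hi x)
    (J : nat) (hJ : gap lo hi J (escape_point g lo hi x))
    (X : set nat)
    (hX : forall i, X i ->
       (piece lo hi i)° `&` (mk_domain lo hi `&` g @^-1` (gap lo hi J)) = set0)
    (A : cstarAlg R) (s : nat -> A) (p : set nat -> A)
    (hA : @is_ug_algebra R (markov_ultragraph g lo hi) X A s p) :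
  [/\ exists nu, is_nu g lo hi x s p nu,
      exists pi, is_pi g lo hi x s p pi
    & forall nu pi, is_nu g lo hi x s p nu -> is_pi g lo hi x s p pi ->
        nu = pi].
Proof.
have fam := vertex_edge_family hg hJ hX.
have [_ univ] := hA.
have [phi [[phi_hom phi_s phi_p] phi_uniq]] := univ _ _ _ fam.
have phi_rep := star_hom_rep phi_hom.
have uniq rho : star_rep rho ->
    (forall C, @ug_sets (markov_ultragraph g lo hi) C ->
       rho (p C) = vertex_op g lo hi x C) ->
    (forall i, rho (s i) = edge_op hg hJ i) -> rho = fun c => bop_val (phi c).
  move=> hr rp rs.
  (* A representation is determined by its values on the generators. *)
  have -> // : phi = fun c => Bop (star_rep_mem hr c).
  apply: phi_uniq; split; first exact: star_rep_hom.
  - by move=> e; apply: val_inj; exact: rs.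
  - by move=> C hC; apply: val_inj; exact: rp.
have nu_uniq nu : is_nu g lo hi x s p nu -> nu = fun c => bop_val (phi c).
  move=> [hr hW hT]; apply: (uniq _ hr) => [C hC|i].
    by rewrite -(@is_W_uniq _ _ _ _ _ _ (Bop (star_rep_mem hr (p C))) (hW C hC)).
  by rewrite -(@is_T_uniq _ _ _ _ _ _ hg _ _ hJ _ (Bop (star_rep_mem hr (s i))) (hT i)).
have pi_uniq pi : is_pi g lo hi x s p pi -> pi = fun c => bop_val (phi c).
  move=> [hr hP hS]; apply: (uniq _ hr) => [C hC|i]; apply/funext => F;
    apply: ell2P => y _.
  - by rewrite (hP C hC) vertex_opE.
  - by rewrite hS edge_opE.
split.
- exists (fun c => bop_val (phi c)); split=> // [C hC|i].
    by rewrite phi_p//; exact: vertex_op_is_W.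
  by rewrite phi_s; exact: edge_op_is_T.
- exists (fun c => bop_val (phi c)); split=> // [C hC F y|i F y].
    by rewrite phi_p// vertex_opE.
  by rewrite phi_s edge_opE.
- by move=> nu pi /nu_uniq -> /pi_uniq ->.
Qed.
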